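(* For each $N\in\mathbb{N}$ let $X_N$ be a real symmetric $N\times N$ random matrix. Assume the following. (1) The family of random variables $\{N[X_N]_{ij}^2 : N\in\mathbb{N},\ 1\le i,j\le N\}$ is uniformly integrable. (2) For each $N$ there are a set partition $\Pi_N$ of $\{(i,j): 1\le i\le j\le N\}$ and a constant $d_N$, with $d_N=o(\log N)$ as $N\to\infty$, such that each block of $\Pi_N$ has at most $d_N$ elements, and the random vectors $\left([X_N]_{ij}\right)_{(i,j)\in P}$, indexed by the blocks $P\in\Pi_N$, are independent. Let $\mu_N$ be the empirical spectral distribution of $X_N$. Then $\mu_N$ converges weakly in probability to its mean: for every bounded continuous function $f:\mathbb{R}\to\mathbb{R}$, $$\int f\,d\mu_N-\mathbb{E}\left(\int f\,d\mu_N\right)\longrightarrow 0\quad\text{in probability as } N\to\infty.$$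
   Context: For a real symmetric $N\times N$ random matrix $X_N$ with eigenvalues $\lambda_1^N\le\cdots\le\lambda_N^N$ (with multiplicity), the empirical spectral distribution of $X_N$ is the random probability measure $\mu_N=\frac1N\sum_{j=1}^N\delta_{\lambda_j^N}$ on $\mathbb{R}$. $[X_N]_{ij}$ denotes the $(i,j)$ entry of $X_N$. *)

(* Defs.v *)
From HB Require Import structures.
From mathcomp Require Import all_boot all_order all_algebra.
From mathcomp Require Import polyrcf.
From mathcomp Require Import all_classical all_reals all_analysis.

Set Implicit Arguments.
Unset Strict Implicit.
Unset Printing Implicit Defensive.

Import Order.TTheory GRing.Theory Num.Theory.
Import numFieldNormedType.Exports.

Local Open Scope classical_set_scope.
Local Open Scope ring_scope.

(* The real eigenvalues of A in nondecreasing order, each repeated according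
   to its multiplicity as a root of the characteristic polynomial. For a
   symmetric A this list has size n. *)
Definition eigenvalues (R : rcfType) (n : nat) (A : 'M[R]_n) : seq R :=
  flatten [seq nseq (mup x (char_poly A)) x | x <- rootsR (char_poly A)].

Definition esd (R : realType) (n : nat) (A : 'M[R]_n) :
    {measure set R -> \bar R} :=
  mscale (n%:R^-1)%:nng (msum (fun j => \d_((eigenvalues A)`_j)) n).

Definition random_mx (d : measure_display) (T : measurableType d)
    (R : realType) (P : probability T R) (n : nat)
    (X : 'I_n -> 'I_n -> {RV P >-> R}) (w : T) : 'M[R]_n :=
  \matrix_(i, j) X i j w.

Definition upper_triangle (n : nat) : {set 'I_n * 'I_n} :=
  [set p : 'I_n * 'I_n | (p.1 <= p.2)%N].

(* The family (X p)_{p in B}, for a finite set B of indices, as a random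
   vector with values in R^#|B|. *)
Definition block_vector (d : measure_display) (T : measurableType d)
    (R : realType) (P : probability T R) (n : nat)
    (X : 'I_n -> 'I_n -> {RV P >-> R}) (B : {set 'I_n * 'I_n}) (w : T) :
    #|B|.-tuple R :=
  [tuple X (enum_val k).1 (enum_val k).2 w | k < #|B|].

Definition independent_family (d : measure_display) (T : measurableType d)
    (R : realType) (P : probability T R) (I : finType) (D : {set I})
    (d' : I -> measure_display) (S : forall i, measurableType (d' i))
    (Y : forall i, T -> S i) : Prop :=
  forall (J : {set I}) (A : forall i, set (S i)),
    J \subset D -> (forall i, i \in J -> measurable (A i)) ->
    P (\bigcap_(i in [set` J]) (Y i @^-1` A i)) =
    (\prod_(i in J) P (Y i @^-1` A i))%E.

(* The members of the family may live on different probability spaces. *)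
Definition uniformly_integrable (R : realType) (I : Type)
    (d : I -> measure_display) (T : forall i, measurableType (d i))
    (P : forall i, probability (T i) R) (Y : forall i, T i -> R) : Prop :=
  forall e : R, 0 < e -> exists K : R, forall i : I,
    (\int[P i]_(w in [set w | (K <= `|Y i w|)%R]) `|Y i w|%:E <= e%:E)%E.

Definition cvg_in_probability (R : realType) (d : nat -> measure_display)
    (T : forall n, measurableType (d n)) (P : forall n, probability (T n) R)
    (Y : forall n, T n -> R) (c : R) : Prop :=
  forall e : R, 0 < e ->
    P n [set w | e < `|Y n w - c|] @[n --> \oo] --> 0%E.

(* Main.v *)
(* Given a tolerance, f is approximated by a function q with |f - q| <= e (1 + x^2)
   and a uniform quadratic Taylor bound; the error is controlled because the mean
   of (1/N) tr X^2 is bounded. By uniform integrability the entries may be truncated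
   at L/sqrt N and rounded to finitely many values, so that the independent blocks
   live on a finite product space. There the Efron-Stein inequality bounds the
   variance of tr q by the sum over blocks of the squared influence of erasing a
   block. The first-order Taylor term of tr q at A is the entrywise inner product
   with G = q'(A), whose squared Hilbert-Schmidt norm is at most N sup|q'|^2; by
   Cauchy-Schwarz blockwise the sum of the influences is O(d_N), hence the variance
   of (1/N) tr q is O(d_N / N^2), which tends to 0. *)
Require Import Defs.
From mathcomp Require Import all_boot all_order all_algebra.
From mathcomp Require Import polyrcf complex ring lra.
From mathcomp Require Import all_classical all_reals all_analysis.
From mathcomp Require Import measurable_realfun.
Import Order.TTheory GRing.Theory Num.Theory.
Import numFieldNormedType.Exports.
Local Open Scope classical_set_scope.
Local Open Scope ring_scope.

Set Implicit Arguments.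
Unset Strict Implicit.
Unset Printing Implicit Defensive.

(** Bounded influences alone are too weak. There can be of order N^2 independent entries, and a rank
    inequality only says that erasing one moves the eigenvalue sum by O(1), which leaves a variance
    of order N^2 and nothing after division by N^2. The gain has to come from the size N^(-1/2) of
    the entries, and the Hilbert-Schmidt norm measures it whatever the shape of a block. This needs
    a test function smoother than [f]; the weight 1 + x^2 in the approximation is what the second
    moment of the spectrum can pay for at infinity. The smoothness is a two-point scalar inequality
    rather than a derivative: it passes to matrices by averaging over pairs of eigenvalues, so
    perturbation theory of single eigenvalues never enters. Rounding to finitely many values turns
    conditional expectations and product measures into finite sums. Its cost is an inner product of
    G with a small matrix, absorbed by Young's inequality. The same rounding also yields
    measurability of the spectral statistics as pointwise limits. *)

(** * Spectral theorem for real symmetric matrices *)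

(** Over the complex extension [A] is Hermitian, so its spectral diagonal is real. The root descends
    to [R] because the characteristic polynomial commutes with the field embedding. *)
Lemma symmetric_real_eigenvalue (R : rcfType) (n : nat) (A : 'M[R]_n.+1) :
  A^T = A -> exists a : R, eigenvalue A a.
Proof.
move=> symA; pose Ac := map_mx (real_complex R) A.
have herm : Ac \is hermsymmx.
  apply: realsym_hermsym.
    apply/is_hermitianmxP.
    by rewrite expr0 scale1r map_mx_id // map_trmx symA.
  by apply/mxOverP => i j; rewrite mxE; apply/complex_realP; exists (A i j).
have /mxOverP/(_ 0 0)/complex_realP[a aE] := hermitian_spectral_diag_real herm.
exists a; rewrite eigenvalue_root_char -(fmorph_root (real_complex R)).
rewrite map_char_poly -eigenvalue_root_char; apply/eigenvalueP.
have /hermitian_normalmx/orthomx_spectralP AcE := herm.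
have Pu := spectral_unit Ac.
exists (row 0 (spectralmx Ac)); last first.
  apply/eqP => P0; have := congr1 (row 0) (mulmxV Pu).
  rewrite row_mul P0 mul0mx => /rowP/(_ 0).
  by rewrite !mxE => /eqP; rewrite eq_sym oner_eq0.
rewrite -row_mul -/Ac [in X in _ *m X]AcE !mulmxA mulmxV // mul1mx.
by apply/rowP => j; rewrite !mxE (bigD1 0) //= !mxE eqxx mulr1n big1 ?addr0 ?aE // => k k0;
   rewrite !mxE eq_sym (negPf k0) mulr0n mul0r.
Qed.

(* H is the Householder reflection exchanging v and the first basis vector. *)
Lemma orthogonal_to_first (R : rcfType) (n : nat) (v : 'rV[R]_n.+1) :
  v *m v^T = 1%:M ->
  exists H : 'M[R]_n.+1, [/\ H *m H^T = 1%:M & row 0 H = v].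
Proof.
move=> vv; set e : 'rV[R]_n.+1 := delta_mx 0 0.
have [ve|/eqP ve] := eqVneq v e.
  exists 1%:M; split; first by rewrite trmx1 mulmx1.
  by rewrite ve; apply/rowP => i; rewrite !mxE eqxx eq_sym.
have [u uE] : exists u, u = v - e by exists (v - e).
pose s := (u *m u^T) 0 0.
have sE : u *m u^T = s%:M by rewrite [LHS]mx11_scalar.
have ee : e *m e^T = 1%:M.
  by rewrite /e trmx_delta mul_delta_mx [LHS]mx11_scalar mxE !eqxx.
have evC : v *m e^T = e *m v^T.
  by rewrite [LHS]mx11_scalar [RHS]mx11_scalar !mxE; congr _%:M;
     apply: eq_bigr => i _; rewrite !mxE mulrC.
have s0 : s != 0.
  apply/eqP => s0; apply: ve; apply/eqP; rewrite -subr_eq0 -uE.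
  apply/eqP/rowP => i; rewrite !mxE.
  move: s0; rewrite /s mxE => /eqP; rewrite psumr_eq0; last first.
    by move=> j _; rewrite !mxE -expr2 sqr_ge0.
  by move/allP/(_ i (mem_index_enum _)); rewrite !mxE mulf_eq0 orbb => /eqP.
pose H := 1%:M - (2 / s) *: (u^T *m u).
have HT : H^T = H.
  by rewrite /H raddfB /= trmx1 linearZ /= trmx_mul trmxK.
exists H; split.
  rewrite HT /H mulmxBl mul1mx mulmxBr mulmx1 -scalemxAl -scalemxAr.
  rewrite -mulmxA [u *m (_ *m _)]mulmxA sE mul_scalar_mx -scalemxAr.
  rewrite !scalerA; apply/matrixP=> i j; rewrite !mxE; field; exact: s0.
(* For unit vectors |v - e|^2 = 2 - 2 <e, v>, hence <e, u> = - s / 2, and the reflection moves [e]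
   by exactly [u]. *)
have sE2 : s = 2 - 2 * (e *m v^T) 0 0.
  have : u *m u^T = (2 - 2 * (e *m v^T) 0 0)%:M.
    rewrite uE raddfB /= mulmxBl !mulmxBr vv ee evC.
    rewrite [e *m v^T]mx11_scalar; apply/matrixP => i j.
    rewrite !ord1 !mxE !eqxx !mulr1n; ring.
  by rewrite sE => /matrixP/(_ 0 0); rewrite !mxE !eqxx !mulr1n.
rewrite rowE -/e /H mulmxBr mulmx1 -scalemxAr mulmxA.
have -> : e *m u^T = (- s / 2)%:M.
  rewrite uE raddfB /= mulmxBr ee [e *m v^T]mx11_scalar sE2 -raddfB /=.
  by congr _%:M; field.
rewrite mul_scalar_mx scalerA.
have -> : 2 / s * (- s / 2) = -1 by field; exact: s0.
by rewrite scaleN1r opprK uE addrC subrK.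
Qed.

Lemma orthogonalC (R : comUnitRingType) n (Q : 'M[R]_n) :
  Q *m Q^T = 1%:M -> Q^T *m Q = 1%:M.
Proof. exact: mulmx1C. Qed.

Lemma unit_row (R : rcfType) n (v : 'rV[R]_n) : v != 0 ->
  exists2 c : R, c != 0 & (c *: v) *m (c *: v)^T = 1%:M.
Proof.
move=> v0; pose s := (v *m v^T) 0 0.
have s0 : 0 < s.
  rewrite lt_def /s mxE; apply/andP; split; last first.
    by apply: sumr_ge0 => j _; rewrite !mxE -expr2 sqr_ge0.
  apply: contraNneq v0 => /eqP; rewrite psumr_eq0; last first.
    by move=> j _; rewrite !mxE -expr2 sqr_ge0.
  move/allP => h; apply/eqP/rowP => i; have := h i (mem_index_enum _).
  by rewrite !mxE mulf_eq0 orbb => /eqP.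
exists (Num.sqrt s)^-1; first by rewrite invr_eq0 sqrtr_eq0 -ltNge.
rewrite linearZ /= -scalemxAl -scalemxAr [v *m _]mx11_scalar -/s.
rewrite scale_scalar_mx scale_scalar_mx mulrA -invfM -expr2 sqr_sqrtr ?ltW //.
by rewrite mulVf // gt_eqF.
Qed.

(** Deflation: conjugation by an orthogonal matrix whose first row is a unit eigenvector clears the
    first row off the diagonal, symmetry clears the first column, and the induction goes on in the
    lower right block. *)
Theorem symmetric_spectral (R : rcfType) n (A : 'M[R]_n) : A^T = A ->
  exists (Q : 'M[R]_n) (l : 'rV[R]_n),
    Q *m Q^T = 1%:M /\ A = Q^T *m diag_mx l *m Q.
Proof.
elim: n A => [|n IHn] A symA.
  by exists 1%:M, 0; split; apply/matrixP => -[].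
have [a /eigenvalueP[v0 vA /unit_row[c c0 vv]]] := symmetric_real_eigenvalue symA.
have [H [HH Hv]] := orthogonal_to_first vv.
set v := c *: v0 in vv Hv.
have vAE : v *m A = a *: v by rewrite /v -scalemxAl vA scalerA mulrC -scalerA.
have [B BE] : exists B : 'M[R]_(1 + n), B = H *m A *m H^T by exists (H *m A *m H^T).
have BT : B^T = B by rewrite BE !trmx_mul trmxK symA mulmxA.
have Brow : row 0 B = a *: delta_mx 0 0.
  rewrite BE !row_mul Hv vAE -Hv -scalemxAl -row_mul HH; congr (_ *: _).
  by apply/rowP => i; rewrite !mxE eqxx eq_sym.
have B0 j : B 0 j = (a * (j == 0)%:R).
  by have /rowP/(_ j) := Brow; rewrite !mxE eqxx eq_sym.
have l0 (i : 'I_1) : lshift n i = 0 by apply: val_inj; rewrite ord1.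
have Bul : ulsubmx B = a%:M.
  by apply/matrixP => i j; rewrite !mxE !l0 B0 !ord1 !eqxx mulr1.
have Bur : ursubmx B = 0.
  by apply/matrixP => i j; rewrite !mxE !l0 B0 mulr0.
have Bdl : dlsubmx B = 0.
  by rewrite -[B]BT -trmx_ursub Bur trmx0.
have [|Q [l [QQ drE]]] := IHn (drsubmx B); first by rewrite trmx_drsub BT.
pose M : 'M[R]_(1 + n) := block_mx 1%:M 0 0 Q.
have MM : M *m M^T = 1%:M.
  rewrite /M tr_block_mx !trmx0 trmx1 mulmx_block.
  by rewrite !mulmx0 !mul0mx !addr0 add0r mulmx1 QQ -scalar_mx_block.
have MB : B = M^T *m diag_mx (row_mx a%:M l) *m M.
  rewrite /M -[LHS]submxK Bul Bur Bdl drE diag_mx_row tr_block_mx !trmx0 trmx1.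
  rewrite !mulmx_block !(mulmx0, mul0mx, addr0, add0r, mulmx1, mul1mx).
  by congr block_mx; apply/matrixP=> i j; rewrite !mxE !ord1.
exists (M *m (H : 'M[R]_(1 + n))), (row_mx a%:M l); split.
  by rewrite trmx_mul mulmxA -[_ *m H *m _]mulmxA HH mulmx1 MM.
have HH' := orthogonalC HH.
have -> : A = H^T *m B *m H.
  by rewrite BE !mulmxA HH' mul1mx -mulmxA HH' mulmx1.
by rewrite trmx_mul MB !mulmxA.
Qed.

(** * Eigenvalue sums and their expansion in the matrix *)

(** Both lists contain each x as often as x is a root of the characteristic polynomial. This frees
    later arguments from the order of the roots. *)
Lemma perm_eigenvalues (R : rcfType) n (A : 'M[R]_n) (s : seq R) :
  char_poly A = \prod_(x <- s) ('X - x%:P) -> perm_eq (eigenvalues A) s.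
Proof.
move=> pE; have p0 : char_poly A != 0 by rewrite monic_neq0 // char_poly_monic.
apply/allP => x _ /=; apply/eqP.
rewrite -(mu_prod_XsubC x s) -pE /eigenvalues count_flatten sumnE !big_map.
under eq_bigr => y _ do rewrite count_nseq.
have [px|px] := boolP (x \in rootsR (char_poly A)).
  rewrite (bigD1_seq x) //= ?uniq_roots // eqxx mul1n big1 ?addn0 // => y yx.
  by rewrite (negPf yx).
rewrite mupNroot; last first.
  by apply: contra px; rewrite -roots_on_rootsR // in_itv.
rewrite big_seq big1 // => y py /=; have [yx|//] := eqVneq y x.
by rewrite yx (negPf px) in py.
Qed.

(** For symmetric [A] this is tr f(A), without the factor 1/n. *)
Definition eigensum (R : rcfType) n (f : R -> R) (A : 'M[R]_n) : R :=
  \sum_(j < n) f (eigenvalues A)`_j.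

(** The Hilbert-Schmidt inner product; the sum runs over all ordered pairs, so each off-diagonal
    entry of a symmetric matrix counts twice. *)
Definition entry_dot (R : pzRingType) n (A B : 'M[R]_n) : R :=
  \sum_p A p.1 p.2 * B p.1 p.2.

Definition spectral_mx (R : pzRingType) n (Q : 'M[R]_n) (l : 'rV[R]_n) :=
  Q^T *m diag_mx l *m Q.

Lemma spectral_mx_sym (R : comPzRingType) n (Q : 'M[R]_n) l :
  (spectral_mx Q l)^T = spectral_mx Q l.
Proof. by rewrite !trmx_mul trmxK tr_diag_mx mulmxA. Qed.

Lemma eigensum_spectral (R : rcfType) n (f : R -> R) (Q : 'M[R]_n) l :
  Q *m Q^T = 1%:M -> eigensum f (spectral_mx Q l) = \sum_i f (l 0 i).
Proof.
move=> QQ; have [Qu _] := mulmx1_unit QQ.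
have QT : Q^T = invmx Q.
  by rewrite -[LHS]mul1mx -(mulVmx Qu) -mulmxA QQ mulmx1.
have cpE : char_poly (spectral_mx Q l) =
    \prod_(x <- [seq l 0 i | i <- enum 'I_n]) ('X - x%:P).
  rewrite big_map big_enum /= (_ : char_poly _ = char_poly (diag_mx l)).
    rewrite char_poly_trig ?diag_mx_is_trig //.
    by apply: eq_bigr => i _; rewrite mxE eqxx.
  rewrite /spectral_mx QT /char_poly /char_poly_mx.
  rewrite !map_mxM.
  (* Writing the scalar matrix X as its own conjugate makes the whole characteristic matrix a
     conjugate, so the determinants agree. *)
  have XE : 'X%:M = map_mx (@polyC R) (invmx Q) *m 'X%:M *m map_mx (@polyC R) Q.
    rewrite mul_mx_scalar -scalemxAl -map_mxM mulVmx //.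
    by rewrite map_mx1 scalemx1.
  rewrite [X in \det (X - _) = _]XE -mulmxBl -mulmxBr !det_mulmx mulrC mulrA -det_mulmx -map_mxM mulmxV //.
  by rewrite map_mx1 det1 mul1r.
have pe := perm_eigenvalues cpE.
have sz : size (eigenvalues (spectral_mx Q l)) = n.
  by rewrite (perm_size pe) size_map size_enum_ord.
transitivity (\sum_(x <- eigenvalues (spectral_mx Q l)) f x).
  by rewrite (big_nth 0) sz big_mkord.
by rewrite (perm_big _ pe) big_map big_enum.
Qed.

Lemma entry_dot_trace (R : comPzRingType) n (A B : 'M[R]_n) :
  entry_dot A B = \tr (A *m B^T).
Proof.
rewrite /entry_dot /mxtrace -(pair_bigA _ (fun i j => A i j * B i j)) /=.
by apply: eq_bigr => i _; rewrite mxE; apply: eq_bigr => j _; rewrite mxE.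
Qed.

Lemma entry_dotC (R : comPzRingType) n (A B : 'M[R]_n) :
  entry_dot A B = entry_dot B A.
Proof. by apply: eq_bigr => p _; rewrite mulrC. Qed.

Lemma entry_dotBr (R : comPzRingType) n (A B C : 'M[R]_n) :
  entry_dot A (B - C) = entry_dot A B - entry_dot A C.
Proof.
by rewrite -sumrB; apply: eq_bigr => p _; rewrite !mxE mulrBr.
Qed.

Lemma entry_dot_ge0 (R : realDomainType) n (A : 'M[R]_n) : 0 <= entry_dot A A.
Proof. by apply: sumr_ge0 => p _; rewrite -expr2 sqr_ge0. Qed.

(** With the overlap matrix W = Q Q'^T of the two bases, the trace becomes tr(D W D' W^T), where D
    and D' are the diagonal matrices of [l] and [l']. When both bases are orthogonal, the squared
    entries of W are doubly stochastic weights. *)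
Lemma entry_dot_spectral (R : comPzRingType) n (Q Q' : 'M[R]_n) l l' :
  entry_dot (spectral_mx Q l) (spectral_mx Q' l') =
  \sum_i \sum_j (Q *m Q'^T) i j ^+ 2 * (l 0 i * l' 0 j).
Proof.
rewrite entry_dot_trace spectral_mx_sym /spectral_mx.
set W := Q *m Q'^T.
have -> : \tr (Q^T *m diag_mx l *m Q *m (Q'^T *m diag_mx l' *m Q')) =
    \tr (diag_mx l *m W *m (diag_mx l' *m W^T)).
  by rewrite -!mulmxA mxtrace_mulC /W trmx_mul trmxK !mulmxA.
rewrite /mxtrace; apply: eq_bigr => i _; rewrite mxE; apply: eq_bigr => j _.
by rewrite !mul_diag_mx !mxE expr2; ring.
Qed.

Lemma orthogonal_row_sum (R : comPzRingType) n (W : 'M[R]_n) i :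
  W *m W^T = 1%:M -> \sum_j W i j ^+ 2 = 1.
Proof.
move=> /matrixP/(_ i i); rewrite !mxE eqxx mulr1n => <-.
by apply: eq_bigr => j _; rewrite mxE expr2.
Qed.

Lemma orthogonal_col_sum (R : comUnitRingType) n (W : 'M[R]_n) j :
  W *m W^T = 1%:M -> \sum_i W i j ^+ 2 = 1.
Proof.
move=> /orthogonalC/matrixP/(_ j j); rewrite !mxE eqxx mulr1n => <-.
by apply: eq_bigr => i _; rewrite mxE expr2.
Qed.

(** [g] stands for the derivative of [q]. An inequality between two points, linear in the values of
    [q], survives averaging with nonnegative weights, which is all that the matrix version needs. *)
Definition quad_taylor (R : realDomainType) (q : R -> R) (C M : R) :=
  exists g : R -> R, (forall x, `|g x| <= M) /\
    forall x y, `|q y - q x - g x * (y - x)| <= C * (y - x) ^+ 2.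

(* In eigenbases of A and A', both sides are averages of their scalar
   counterparts with respect to the doubly stochastic weights
   [(Q Q'^T) i j ^+ 2]. *)
Lemma eigensum_taylor (R : rcfType) n (q : R -> R) (C M : R) (A : 'M[R]_n) :
  quad_taylor q C M -> A^T = A ->
  exists G : 'M[R]_n, entry_dot G G <= n%:R * M ^+ 2 /\
    forall A' : 'M[R]_n, A'^T = A' ->
    `|eigensum q A' - eigensum q A - entry_dot G (A' - A)| <=
      C * entry_dot (A' - A) (A' - A).
Proof.
move=> [g [gM qT]] /symmetric_spectral[Q [l [QQ ->]]].
rewrite -/(spectral_mx Q l).
exists (spectral_mx Q (map_mx g l)); split.
  rewrite entry_dot_spectral QQ.
  rewrite (eq_bigr (fun i => g (l 0 i) ^+ 2)) => [|i _]; last first.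
    rewrite (bigD1 i) //= big1 ?addr0 => [|j ji].
      by rewrite !mxE eqxx expr1n mul1r expr2.
    by rewrite mxE eq_sym (negPf ji) expr0n mul0r.
  rewrite mulr_natl -[X in _ *+ X]card_ord -sumr_const; apply: ler_sum => i _.
  by rewrite -real_normK ?num_real // lerXn2r ?nnegrE // (le_trans _ (gM 0)).
move=> A' /symmetric_spectral[Q' [l' [QQ' ->]]].
rewrite -/(spectral_mx Q' l').
set W := Q *m Q'^T.
have WW : W *m W^T = 1%:M.
  by rewrite /W trmx_mul trmxK -!mulmxA [Q'^T *m _]mulmxA orthogonalC ?mul1mx.
have QQE (u v : 'rV[R]_n) : entry_dot (spectral_mx Q u) (spectral_mx Q v) =
    \sum_i \sum_j W i j ^+ 2 * (u 0 i * v 0 i).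
  rewrite entry_dot_spectral QQ; apply: eq_bigr => i _.
  rewrite -mulr_suml orthogonal_row_sum // mul1r (bigD1 i) //= big1.
    by rewrite addr0 mxE eqxx expr1n mul1r.
  by move=> j ji; rewrite mxE eq_sym (negPf ji) expr0n mul0r.
have QQE' (v : 'rV[R]_n) : entry_dot (spectral_mx Q' v) (spectral_mx Q' v) =
    \sum_i \sum_j W i j ^+ 2 * (v 0 j * v 0 j).
  rewrite exchange_big entry_dot_spectral QQ'; apply: eq_bigr => j _ /=.
  rewrite -mulr_suml orthogonal_col_sum // mul1r (bigD1 j) //= big1.
    by rewrite addr0 mxE eqxx expr1n mul1r.
  by move=> i ij; rewrite mxE eq_sym (negPf ij) expr0n mul0r.
rewrite !eigensum_spectral //.
have -> : \sum_i q (l 0 i) = \sum_i \sum_j W i j ^+ 2 * q (l 0 i).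
  by apply: eq_bigr => i _; rewrite -mulr_suml orthogonal_row_sum // mul1r.
have -> : \sum_i q (l' 0 i) = \sum_i \sum_j W i j ^+ 2 * q (l' 0 j).
  rewrite exchange_big; apply: eq_bigr => i _ /=.
  by rewrite -mulr_suml orthogonal_col_sum // mul1r.
have -> : entry_dot (spectral_mx Q' l' - spectral_mx Q l)
    (spectral_mx Q' l' - spectral_mx Q l) =
    \sum_i \sum_j W i j ^+ 2 * (l' 0 j - l 0 i) ^+ 2.
  rewrite entry_dotBr ![entry_dot (_ - _) _]entry_dotC !entry_dotBr QQE QQE'.
  rewrite [entry_dot (spectral_mx Q' _) _]entry_dotC entry_dot_spectral.
  rewrite -!sumrB; apply: eq_bigr => i _; rewrite -!sumrB.
  by apply: eq_bigr => j _; rewrite -/W; ring.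
rewrite entry_dotBr QQE entry_dot_spectral -!sumrB mulr_sumr.
apply: (le_trans (ler_norm_sum _ _ _)); apply: ler_sum => i _.
rewrite -!sumrB mulr_sumr.
apply: (le_trans (ler_norm_sum _ _ _)); apply: ler_sum => j _.
rewrite -/W [map_mx g l 0 i]mxE -!mulrBr normrM ger0_norm ?sqr_ge0 // mulrCA.
by rewrite ler_wpM2l ?sqr_ge0 // qT.
Qed.

(** The squared eigenvalues add up to [entry_dot A A], so summing the scalar bound over the spectrum
    gives the claim. *)
Lemma eigensum_dist (R : rcfType) n (f q : R -> R) (e : R) (A : 'M[R]_n) :
  (forall x, `|f x - q x| <= e * (1 + x ^+ 2)) -> A^T = A ->
  `|eigensum f A - eigensum q A| <= e * (n%:R + entry_dot A A).
Proof.
move=> fq /symmetric_spectral[Q [l [QQ ->]]]; rewrite -/(spectral_mx Q l).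
rewrite !eigensum_spectral // entry_dot_spectral QQ -sumrB.
apply: (le_trans (ler_norm_sum _ _ _)).
rewrite -[n in n%:R]card_ord -sumr_const -big_split /= mulr_sumr.
apply: ler_sum => i _; apply: (le_trans (fq _)).
rewrite (bigD1 i) //= big1 ?mxE ?eqxx ?expr1n ?addr0 ?mul1r ?expr2 //.
by move=> j ji; rewrite mxE eq_sym (negPf ji) expr0n mul0r.
Qed.

(** * Influence of one block on the eigenvalue sum *)

(** Mirror entries share one index in the upper triangle, hence lie in the same block of the
    partition. *)
Definition upper_index n (p : 'I_n * 'I_n) : 'I_n * 'I_n :=
  if (p.1 <= p.2)%N then p else (p.2, p.1).

(** Both mirror copies are erased: the result stays symmetric, as the Taylor bound requires, and no
    longer depends on the variables of the block, as the Efron-Stein inequality requires. *)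
Definition erase_block (R : pzRingType) n (B : {set 'I_n * 'I_n})
    (A : 'M[R]_n) : 'M[R]_n :=
  \matrix_(i, j) if upper_index (i, j) \in B then 0 else A i j.

Lemma upper_index_sym n (i j : 'I_n) : upper_index (i, j) = upper_index (j, i).
Proof.
rewrite /upper_index /=; case: (leqP i j) => ij; case: (leqP j i) => ji //.
  by have -> : i = j by apply: val_inj; apply/eqP; rewrite eqn_leq ij.
by have := ltn_trans ij ji; rewrite ltnn.
Qed.

Lemma upper_index_upper n (p : 'I_n * 'I_n) :
  upper_index p \in upper_triangle n.
Proof.
by rewrite /upper_index inE; case: (leqP p.1 p.2) => //= /ltnW.
Qed.

Lemma erase_block_sym (R : pzRingType) n (B : {set 'I_n * 'I_n})
    (A : 'M[R]_n) : A^T = A -> (erase_block B A)^T = erase_block B A.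
Proof.
move=> symA; apply/matrixP => i j; rewrite !mxE upper_index_sym.
by rewrite -[in A j i]symA mxE.
Qed.

Lemma card_upper_index_preim n (B : {set 'I_n * 'I_n}) :
  (#|[set p | upper_index p \in B]| <= 2 * #|B|)%N.
Proof.
pose swap (p : 'I_n * 'I_n) := (p.2, p.1).
apply: (@leq_trans #|B :|: swap @: B|).
  apply/subset_leq_card/fintype.subsetP => -[i j].
  rewrite !inE /upper_index /=; case: ifP => _ h; first by rewrite h.
  by apply/orP; right; apply/imsetP; exists (j, i).
rewrite mul2n -addnn; apply: (leq_trans (leq_card_setU _ _)).
by rewrite leq_add2l leq_imset_card.
Qed.

Lemma sum_blocks (R : nmodType) n (Pi : {set {set 'I_n * 'I_n}})
    (h : 'I_n * 'I_n -> R) :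
  finset.partition Pi (upper_triangle n) ->
  \sum_(B in Pi) \sum_(p | upper_index p \in B) h p = \sum_p h p.
Proof.
move=> /and3P[/eqP cov triv _].
rewrite [RHS](partition_big (fun p => finset.pblock Pi (upper_index p)) (mem Pi)) /=.
  apply: eq_bigr => B BPi; apply: eq_bigl => p.
  apply/idP/eqP => [pB|<-]; first exact: finset.def_pblock.
  by rewrite finset.mem_pblock cov upper_index_upper.
by move=> p _; rewrite finset.pblock_mem // cov upper_index_upper.
Qed.

(** Lagrange's identity: the double sum of the squares (x_i y_j - x_j y_i)^2 is twice the gap. *)
Lemma sum_CauchySchwarz (R : realDomainType) (I : finType) (P : pred I)
    (x y : I -> R) :
  (\sum_(i | P i) x i * y i) ^+ 2 <=
  (\sum_(i | P i) x i ^+ 2) * (\sum_(i | P i) y i ^+ 2).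
Proof.
have : 0 <= \sum_(i | P i) \sum_(j | P j) (x i * y j - x j * y i) ^+ 2.
  by apply: sumr_ge0 => i _; apply: sumr_ge0 => j _; exact: sqr_ge0.
set X2 := \sum_(i | P i) x i ^+ 2; set Y2 := \sum_(i | P i) y i ^+ 2.
set XY := \sum_(i | P i) x i * y i.
suff -> : \sum_(i | P i) \sum_(j | P j) (x i * y j - x j * y i) ^+ 2 =
    2 * (X2 * Y2 - XY ^+ 2).
  by rewrite pmulr_rge0 // subr_ge0.
have E : 2 * (X2 * Y2 - XY ^+ 2) = X2 * Y2 + Y2 * X2 - 2 * (XY * XY) by ring.
rewrite {}E !big_distrlr /= mulr_sumr -big_split -sumrB; apply: eq_bigr => i _.
rewrite mulr_sumr -big_split -sumrB; apply: eq_bigr => j _ /=; ring.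
Qed.

Lemma quad_taylor_ge0 (R : realDomainType) (q : R -> R) (C M : R) :
  quad_taylor q C M -> 0 <= C /\ 0 <= M.
Proof.
move=> [g [gM qT]]; split; last exact: le_trans (gM 0).
by have := le_trans (normr_ge0 _) (qT 0 1); rewrite subr0 expr1n mulr1.
Qed.

(** Let a and b be the squared masses of [A] and [G] on the block and its mirror. The squared
    influence is at most 2 a b + 2 C^2 a^2, and one factor a is bounded by 2 d k, the 2 accounting
    for the mirror entries. Over all blocks the b add up to at most n M^2 and the a to at most n^2
    k. *)
Lemma block_influence (R : rcfType) n (Pi : {set {set 'I_n * 'I_n}})
    (q : R -> R) (C M d k : R) (A : 'M[R]_n) :
  finset.partition Pi (upper_triangle n) ->
  (forall B, B \in Pi -> #|B|%:R <= d) -> 0 <= d ->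
  quad_taylor q C M -> A^T = A -> (forall i j, A i j ^+ 2 <= k) ->
  \sum_(B in Pi) (eigensum q A - eigensum q (erase_block B A)) ^+ 2 <=
    4 * d * k * n%:R * M ^+ 2 + 4 * C ^+ 2 * d * k ^+ 2 * n%:R ^+ 2.
Proof.
move=> part cardB d0 qt symA Ak.
have [C0 M0] := quad_taylor_ge0 qt.
have [G [GM GT]] := eigensum_taylor qt symA.
(* The empty matrix is set apart because [0 <= k] is read off an entry of [A]. *)
have [n0|n0] := posnP n.
  subst n; rewrite big1 ?mulr0 ?mul0r ?expr0n ?mulr0 ?addr0 ?mul0r // => B _.
  by rewrite /eigensum !big_ord0 subrr expr0n.
have k0 : 0 <= k by apply: le_trans (Ak (Ordinal n0) (Ordinal n0)); exact: sqr_ge0.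
pose a (B : {set 'I_n * 'I_n}) := \sum_(p | upper_index p \in B) A p.1 p.2 ^+ 2.
pose b (B : {set 'I_n * 'I_n}) := \sum_(p | upper_index p \in B) G p.1 p.2 ^+ 2.
have a0 B : 0 <= a B by apply: sumr_ge0 => p _; exact: sqr_ge0.
have a_le B : B \in Pi -> a B <= 2 * d * k.
  move=> BPi; apply: (@le_trans _ _ (\sum_(p | upper_index p \in B) k)).
    by apply: ler_sum.
  rewrite sumr_const -[leLHS]mulr_natl ler_wpM2r //.
  apply: (@le_trans _ _ (2 * #|B|)%:R); last by rewrite natrM ler_wpM2l ?cardB.
  rewrite ler_nat; apply: leq_trans (card_upper_index_preim B).
  by apply/subset_leq_card/fintype.subsetP => p; rewrite inE.
have DE B : entry_dot (erase_block B A - A) (erase_block B A - A) = a B.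
  rewrite /a [RHS]big_mkcond; apply: eq_bigr => -[i j] _; rewrite !mxE /=.
  by case: ifP => _; rewrite ?sub0r ?mulrNN ?expr2 // subrr mul0r.
have GE B : entry_dot G (erase_block B A - A) ^+ 2 <= b B * a B.
  apply: le_trans (sum_CauchySchwarz _ _ _).
  rewrite -[X in _ <= X]sqrrN -sumrN big_mkcond le_eqVlt; apply/orP; left.
  apply/eqP; congr (_ ^+ 2); apply: eq_bigr => -[i j] _; rewrite !mxE /=.
  by case: ifP => _; rewrite ?sub0r ?mulrN // subrr mulr0.
have step B : B \in Pi ->
    (eigensum q A - eigensum q (erase_block B A)) ^+ 2 <=
    4 * d * k * b B + 4 * C ^+ 2 * d * k * a B.
  move=> BPi; have := GT _ (erase_block_sym B symA).
  have := GE B; have := a_le _ BPi; have := a0 B; rewrite DE.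
  have : 0 <= b B by apply: sumr_ge0 => p _; exact: sqr_ge0.
  move: (eigensum _ _) (eigensum _ _) (entry_dot _ _) (a B) (b B) => x y s u v.
  move=> v0 u0 ul sv h.
  have r2 : (y - x - s) ^+ 2 <= (C * u) ^+ 2.
    by rewrite -real_normK ?num_real // lerXn2r ?nnegrE ?mulr_ge0.
  have := ler_wpM2l v0 ul; have := ler_wpM2l (mulr_ge0 (sqr_ge0 C) u0) ul.
  (* With p = y - x - s, the inequality (p - s)^2 >= 0 gives (p + s)^2 <= 2 p^2 + 2 s^2. *)
  have := sqr_ge0 (y - x - s - s); nra.
apply: le_trans (ler_sum _ step) _.
rewrite big_split /= -!mulr_sumr (sum_blocks _ part) (sum_blocks _ part).
apply: lerD.
  by rewrite -!mulrA; do !rewrite ler_wpM2l //.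
rewrite expr2 !mulrA -[leRHS]mulrA -[leRHS]mulrA ler_wpM2l //.
  by rewrite !mulr_ge0 // sqr_ge0.
apply: (@le_trans _ _ (\sum_(p : 'I_n * 'I_n) k)); first exact: ler_sum.
by rewrite sumr_const card_prod card_ord -[leLHS]mulr_natl natrM mulrC mulrA.
Qed.

(** * The Efron-Stein inequality on a finite product space *)

Definition update (J V : finType) (z : {ffun J -> V}) (j : J) (v : V) :
    {ffun J -> V} :=
  [ffun i => if i == j then v else z i].

Definition product_weight (R : comPzRingType) (J V : finType)
    (p : J -> V -> R) (z : {ffun J -> V}) : R :=
  \prod_j p j (z j).

Definition product_mean (R : comPzRingType) (J V : finType)
    (p : J -> V -> R) (h : {ffun J -> V} -> R) : R :=
  \sum_z product_weight p z * h z.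

(** The conditional expectation given all coordinates but [j], kept as a function on the full
    product so that such averages can be iterated. *)
Definition coord_mean (R : comPzRingType) (J V : finType) (p : J -> V -> R)
    (j : J) (h : {ffun J -> V} -> R) (z : {ffun J -> V}) : R :=
  \sum_v p j v * h (update z j v).

Lemma update_update (J V : finType) (z : {ffun J -> V}) j v v' :
  update (update z j v) j v' = update z j v'.
Proof. by apply/ffunP => i; rewrite !ffunE; case: eqP. Qed.

Lemma update_id (J V : finType) (z : {ffun J -> V}) j : update z j (z j) = z.
Proof. by apply/ffunP => i; rewrite !ffunE; case: eqP => [->|]. Qed.

Lemma update_same (J V : finType) (z : {ffun J -> V}) j v : update z j v j = v.
Proof. by rewrite ffunE eqxx. Qed.

(** Exchanging coordinate [j] with an independent copy is an involution that preserves the joint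
    weight; reindexing along it gives the tower property. *)
Lemma product_mean_coord_mean (R : comPzRingType) (J V : finType)
    (p : J -> V -> R) (h : {ffun J -> V} -> R) (j : J) :
  \sum_v p j v = 1 -> product_mean p (coord_mean p j h) = product_mean p h.
Proof.
move=> p1; pose swap (u : {ffun J -> V} * V) := (update u.1 j u.2, u.1 j).
have swapK : involutive swap.
  by move=> [z v]; rewrite /swap /= update_update update_id update_same.
have wE (z : {ffun J -> V}) v :
    product_weight p (update z j v) * p j (z j) = product_weight p z * p j v.
  rewrite /product_weight (bigD1 j) //= [X in _ = X * _](bigD1 j) //=.
  rewrite update_same mulrAC [RHS]mulrAC [p j v * _]mulrC; congr (_ * _).
  by apply: eq_bigr => i ij; rewrite ffunE (negPf ij).
transitivity (\sum_(u : {ffun J -> V} * V)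
    product_weight p u.1 * p j u.2 * h (update u.1 j u.2)).
  rewrite -(pair_bigA _ (fun z v =>
    product_weight p z * p j v * h (update z j v))) /=.
  by apply: eq_bigr => z _; rewrite mulr_sumr; apply: eq_bigr => v _; rewrite mulrA.
transitivity (\sum_(u : {ffun J -> V} * V) product_weight p u.1 * p j u.2 * h u.1).
  rewrite [RHS](reindex_inj (inv_inj swapK)) /=.
  by apply: eq_bigr => -[z v] _ /=; rewrite wE.
rewrite -(pair_bigA _ (fun z v => product_weight p z * p j v * h z)) /=.
apply: eq_bigr => z _; rewrite -mulr_suml -mulr_sumr p1 mulr1 //.
Qed.

Lemma coord_mean_update (R : comPzRingType) (J V : finType) (p : J -> V -> R)
    (j : J) (h : {ffun J -> V} -> R) z v :
  coord_mean p j h (update z j v) = coord_mean p j h z.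
Proof. by apply: eq_bigr => v' _; rewrite update_update. Qed.

Lemma coord_mean_const (R : comPzRingType) (J V : finType) (p : J -> V -> R)
    (j : J) (h : {ffun J -> V} -> R) z :
  \sum_v p j v = 1 -> (forall v, h (update z j v) = h z) ->
  coord_mean p j h z = h z.
Proof.
move=> p1 hz; rewrite /coord_mean; under eq_bigr => v _ do rewrite hz.
by rewrite -mulr_suml p1 mul1r.
Qed.

Lemma coord_meanB (R : comPzRingType) (J V : finType) (p : J -> V -> R)
    (j : J) (h k : {ffun J -> V} -> R) z :
  coord_mean p j (fun z => h z - k z) z = coord_mean p j h z - coord_mean p j k z.
Proof. by rewrite -sumrB; apply: eq_bigr => v _; rewrite mulrBr. Qed.

Lemma product_meanD (R : comPzRingType) (J V : finType) (p : J -> V -> R)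
    (h k : {ffun J -> V} -> R) :
  product_mean p (fun z => h z + k z) = product_mean p h + product_mean p k.
Proof. by rewrite -big_split; apply: eq_bigr => v _; rewrite mulrDr. Qed.

Lemma product_meanZ (R : comPzRingType) (J V : finType) (p : J -> V -> R)
    a (h : {ffun J -> V} -> R) :
  product_mean p (fun z => a * h z) = a * product_mean p h.
Proof. by rewrite mulr_sumr; apply: eq_bigr => v _; rewrite mulrCA. Qed.

Lemma eq_product_mean (R : comPzRingType) (J V : finType) (p : J -> V -> R)
    (h k : {ffun J -> V} -> R) :
  h =1 k -> product_mean p h = product_mean p k.
Proof. by move=> hk; apply: eq_bigr => v _; rewrite hk. Qed.

Lemma product_mean_coord_mul (R : comPzRingType) (J V : finType)
    (p : J -> V -> R) (j : J) (h k : {ffun J -> V} -> R) :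
  \sum_v p j v = 1 ->
  product_mean p (fun z => h z * coord_mean p j k z) =
  product_mean p (fun z => coord_mean p j h z * coord_mean p j k z).
Proof.
move=> p1; rewrite -(product_mean_coord_mean _ p1); apply: eq_product_mean => z.
rewrite mulr_suml; apply: eq_bigr => v _.
by rewrite coord_mean_update mulrA.
Qed.

(* Conditioning on all coordinates but [j] is an orthogonal projection. *)
Lemma coord_mean_pythagoras (R : comPzRingType) (J V : finType)
    (p : J -> V -> R) (j : J) (g h : {ffun J -> V} -> R) :
  \sum_v p j v = 1 ->
  product_mean p (fun z => (g z - coord_mean p j g z + coord_mean p j h z) ^+ 2) =
  product_mean p (fun z => (g z - coord_mean p j g z) ^+ 2) +
  product_mean p (fun z => coord_mean p j h z ^+ 2).
Proof.
move=> p1.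
have cross : product_mean p
    (fun z => 2 * ((g z - coord_mean p j g z) * coord_mean p j h z)) = 0.
  rewrite product_meanZ product_mean_coord_mul // /product_mean big1 ?mulr0 //.
  move=> z _; rewrite coord_meanB (@coord_mean_const _ _ _ _ _ (coord_mean p j g)) //.
    by rewrite subrr mul0r mulr0.
  by move=> v; rewrite coord_mean_update.
rewrite -[LHS]subr0 -[X in _ - X]cross -[RHS]addr0.
apply/eqP; rewrite subr_eq addr0 -!product_meanD; apply/eqP/eq_product_mean => z.
ring.
Qed.

Lemma product_mean_sqr_ge0 (R : realDomainType) (J V : finType)
    (p : J -> V -> R) (h : {ffun J -> V} -> R) :
  (forall j v, 0 <= p j v) -> 0 <= product_mean p (fun z => h z ^+ 2).
Proof.
move=> p0; apply: sumr_ge0 => z _; rewrite mulr_ge0 ?sqr_ge0 //.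
exact: prodr_ge0.
Qed.

Lemma coord_mean_contraction (R : realDomainType) (J V : finType)
    (p : J -> V -> R) (j : J) (h : {ffun J -> V} -> R) :
  (forall j v, 0 <= p j v) -> \sum_v p j v = 1 ->
  product_mean p (fun z => coord_mean p j h z ^+ 2) <=
    product_mean p (fun z => h z ^+ 2) /\
  product_mean p (fun z => (h z - coord_mean p j h z) ^+ 2) <=
    product_mean p (fun z => h z ^+ 2).
Proof.
move=> p0 p1; have := coord_mean_pythagoras h h p1.
rewrite (@eq_product_mean _ _ _ _ _ (fun z => h z ^+ 2)) => [->|z]; last by rewrite subrK.
by split; rewrite ?lerDr ?lerDl product_mean_sqr_ge0.
Qed.

(** Coordinates are averaged out one at a time. With m the average over the coordinates already
    treated, g - E_j m = (g - E_j g) + E_j (g - m): Pythagoras separates the two terms and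
    contraction removes E_j from the second. The average over all coordinates is constant, and [z0]
    only supplies a point to read it at. Finally [gs j] ignores coordinate [j], so g - E_j g is the
    centred part of g - gs j and has no larger second moment. *)
Theorem efron_stein (R : realDomainType) (J V : finType) (p : J -> V -> R)
    (g : {ffun J -> V} -> R) (gs : J -> {ffun J -> V} -> R) (z0 : {ffun J -> V}) :
  (forall j v, 0 <= p j v) -> (forall j, \sum_v p j v = 1) ->
  (forall j z v, gs j (update z j v) = gs j z) ->
  exists c, product_mean p (fun z => (g z - c) ^+ 2) <=
    \sum_j product_mean p (fun z => (g z - gs j z) ^+ 2).
Proof.
move=> p0 p1 gsE.
pose means s := foldr (coord_mean p) g s.
have dep (s : seq J) (z z' : {ffun J -> V}) : (forall i, i \notin s -> z i = z' i) -> means s z = means s z'.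
  elim: s z z' => [|j s IHs] z z' zz'.
    by congr g; apply/ffunP => i; exact: zz'.
  apply: eq_bigr => v _; congr (_ * _); apply: IHs => i si; rewrite !ffunE.
  by case: eqP => // /eqP ij; apply: zz'; rewrite inE negb_or ij.
have ES (s : seq J) : product_mean p (fun z => (g z - means s z) ^+ 2) <=
    \sum_(j <- s) product_mean p (fun z => (g z - coord_mean p j g z) ^+ 2).
  elim: s => [|j s IHs].
    rewrite big_nil /product_mean big1 // => z _.
    by rewrite subrr expr0n mulr0.
  rewrite big_cons (@eq_product_mean _ _ _ _ _ (fun z => (g z - coord_mean p j g z +
      coord_mean p j (fun z => g z - means s z) z) ^+ 2)) => [|z]; last first.
    by rewrite coord_meanB /=; congr (_ ^+ 2); ring.
  rewrite coord_mean_pythagoras // lerD2l (le_trans _ IHs) //.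
  by have [] := @coord_mean_contraction _ _ _ _ j (fun z => g z - means s z) p0 (p1 j).
exists (means (enum J) z0).
rewrite (@eq_product_mean _ _ _ _ _ (fun z => (g z - means (enum J) z) ^+ 2)); last first.
  by move=> z; rewrite (dep _ z z0) // => i; rewrite mem_enum.
apply: le_trans (ES _) _; rewrite big_enum; apply: ler_sum => j _.
have [_] := @coord_mean_contraction _ _ _ _ j (fun z => g z - gs j z) p0 (p1 j).
apply: le_trans; rewrite le_eqVlt; apply/orP; left; apply/eqP.
apply: eq_product_mean => z.
rewrite coord_meanB [coord_mean p j (gs j) z]coord_mean_const //.
by congr (_ ^+ 2); ring.
Qed.

(** * Approximation of bounded continuous functions under a quadratic weight *)

Lemma quad_taylor_cst (R : realDomainType) (a : R) :
  quad_taylor (fun=> a) 0 0.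
Proof.
exists (fun=> 0); split=> [x|x y]; first by rewrite normr0.
by rewrite subrr mul0r subr0 normr0 mul0r.
Qed.

Lemma quad_taylorD (R : realDomainType) (q r : R -> R) C M C' M' :
  quad_taylor q C M -> quad_taylor r C' M' ->
  quad_taylor (fun x => q x + r x) (C + C') (M + M').
Proof.
move=> [g [gM qT]] [h [hM rT]]; exists (fun x => g x + h x); split=> [x|x y].
  by rewrite (le_trans (ler_normD _ _)) // lerD.
have -> : q y + r y - (q x + r x) - (g x + h x) * (y - x) =
  (q y - q x - g x * (y - x)) + (r y - r x - h x * (y - x)) by ring.
by rewrite mulrDl (le_trans (ler_normD _ _)) // lerD.
Qed.

Lemma quad_taylor_affine (R : realFieldType) (q : R -> R) C M (c s a : R) :
  quad_taylor q C M ->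
  quad_taylor (fun x => c * q (s * (x - a))) (`|c| * C * s ^+ 2) (`|c| * M * `|s|).
Proof.
move=> [g [gM qT]]; exists (fun x => c * g (s * (x - a)) * s); split=> [x|x y].
  by rewrite !normrM ler_wpM2r // ler_wpM2l.
have := qT (s * (x - a)) (s * (y - a)).
rewrite (_ : s * (y - a) - s * (x - a) = s * (y - x)); last ring.
move=> /(ler_wpM2l (normr_ge0 c)); rewrite -normrM exprMn !mulrA.
congr (`|_| <= _); ring.
Qed.

Lemma quad_taylor_pos (R : realFieldType) (x y : R) :
  `|Num.max y 0 ^+ 2 - Num.max x 0 ^+ 2 - 2 * Num.max x 0 * (y - x)| <=
    (y - x) ^+ 2.
Proof.
have := sqr_ge0 (y - x); have := sqr_ge0 x; have := sqr_ge0 y.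
by rewrite ler_norml; case: (leP x 0) => x0; case: (leP y 0) => y0 hx hy hxy;
  apply/andP; split; nra.
Qed.

(** A piecewise quadratic C^1 step: the second derivative is 4 on (0, 1/2), -4 on (1/2, 1) and 0
    elsewhere, so it climbs from 0 to 1 with slope zero at both ends. *)
Definition quad_step (R : realFieldType) (x : R) : R :=
  2 * Num.max x 0 ^+ 2 - 4 * Num.max (x - 1 / 2) 0 ^+ 2 +
  2 * Num.max (x - 1) 0 ^+ 2.

(** 8 = 2 + 4 + 2 adds the coefficients of the three squares; 2 is the slope at the midpoint, where
    it is largest. *)
Lemma quad_taylor_step (R : realFieldType) : quad_taylor (@quad_step R) 8 2.
Proof.
exists (fun x => 4 * Num.max x 0 - 8 * Num.max (x - 1 / 2) 0 +
  4 * Num.max (x - 1) 0); split=> [x|x y].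
  rewrite ler_norml; case: (leP x 0) => ?; case: (leP (x - 1 / 2) 0) => ?;
    case: (leP (x - 1) 0) => ?; lra.
have := quad_taylor_pos x y.
have := quad_taylor_pos (x - 1 / 2) (y - 1 / 2).
have := quad_taylor_pos (x - 1) (y - 1).
rewrite (_ : y - 1 / 2 - (x - 1 / 2) = y - x); last ring.
rewrite (_ : y - 1 - (x - 1) = y - x); last ring.
rewrite /quad_step !ler_norml => /andP[? ?] /andP[? ?] /andP[? ?]; lra.
Qed.

Lemma quad_step_le0 (R : realFieldType) (x : R) : x <= 0 -> quad_step x = 0.
Proof.
move=> x0; rewrite /quad_step; case: (leP x 0) => ?;
  case: (leP (x - 1 / 2) 0) => ?; case: (leP (x - 1) 0) => ?; lra.
Qed.

Lemma quad_step_ge1 (R : realFieldType) (x : R) : 1 <= x -> quad_step x = 1.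
Proof.
move=> x1; rewrite /quad_step; case: (leP x 0) => ?; first lra.
case: (leP (x - 1 / 2) 0) => ?; first lra.
by case: (leP (x - 1) 0) => ?; [have -> : x = 1 by lra|]; field.
Qed.

Lemma quad_step_itv (R : realFieldType) (x : R) : 0 <= quad_step x <= 1.
Proof.
have [x0|x0] := leP x 0; first by rewrite quad_step_le0 // lexx ler01.
have [x1|x1] := leP 1 x; first by rewrite quad_step_ge1 // lexx ler01.
rewrite /quad_step; case: (leP x 0) => ?; first lra.
by case: (leP (x - 1 / 2) 0) => ?; case: (leP (x - 1) 0) => ?; nra.
Qed.

(** One grid cell is appended at a time. The invariant that [q] is constant to the right of the last
    node lets a scaled step be added there without changing [q] on the left. On the new cell [q] is
    a convex combination of the values of [f] at the two nodes, which preserves both the bound [F]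
    and the error [e]. *)
Lemma quad_interpolation (R : realFieldType) (f : R -> R) (F a h e : R) (m : nat) :
  (forall x, `|f x| <= F) -> 0 < h ->
  (forall x y, a <= x <= a + m%:R * h -> `|x - y| <= h -> `|f x - f y| <= e) ->
  exists q C M, [/\ quad_taylor q C M, forall x, `|q x| <= F,
    forall x, a + m%:R * h <= x -> q x = f (a + m%:R * h) &
    forall x, a <= x <= a + m%:R * h -> `|q x - f x| <= e].
Proof.
move=> fF h0; elim: m => [|m IHm] fe.
  exists (fun=> f a), 0, 0; split=> // [||x]; first exact: quad_taylor_cst.
    by move=> x _; rewrite mul0r addr0.
  rewrite mul0r addr0 => ax; have -> : x = a by apply/eqP; rewrite eq_le andbC.
  by apply: (le_trans _ (fe a a _ _)); rewrite ?subrr ?normr0 ?mul0r ?addr0 ?lexx ?ltW //= lerDl mulr_ge0 // ltW.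
set b := a + m%:R * h in IHm; set c := a + m.+1%:R * h in fe *.
have cb : c = b + h by rewrite /c /b -natr1; ring.
have ab : a <= b by rewrite lerDl mulr_ge0 // ltW.
have [|q [C [M [qt qF qb qe]]]] := IHm.
  by move=> x y /andP[ax xb]; apply: fe; rewrite ax cb (le_trans xb) // lerDl ltW.
pose s x := quad_step (h^-1 * (x - b)).
have sle x : x <= b -> s x = 0.
  by move=> xb; rewrite /s quad_step_le0 // pmulr_rle0 ?invr_gt0 // subr_le0.
have sge x : c <= x -> s x = 1.
  by move=> xc; rewrite /s quad_step_ge1 // mulrC ler_pdivlMr // mul1r; lra.
have s01 x : 0 <= s x <= 1 by exact: quad_step_itv.
have combo x : b <= x -> q x + (f c - f b) * s x = (1 - s x) * f b + s x * f c.
  by move=> bx; rewrite qb //; ring.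
have qt' := quad_taylorD qt
  (quad_taylor_affine (f c - f b) h^-1 b (quad_taylor_step R)).
exists (fun x => q x + (f c - f b) * s x); do 2!eexists; split; first exact: qt'.
- move=> x; have [xb|/ltW bx] := leP x b; first by rewrite sle // mulr0 addr0.
  rewrite combo //; have := s01 x; have := fF b; have := fF c.
  rewrite !ler_norml => /andP[? ?] /andP[? ?] /andP[? ?]; nra.
- by move=> x cx; rewrite combo ?sge //; [ring | lra].
move=> x /andP[ax xc]; have [xb|/ltW bx] := leP x b.
  by rewrite sle // mulr0 addr0 qe // ax.
rewrite combo //; have := s01 x.
have /fe : a <= x <= c by rewrite ax.
move=> fx; have := fx b; have := fx c; rewrite !ler_norml.
move=> /(_ _)/andP[|? ?]; first lra.
move=> /(_ _)/andP[|? ?]; first lra.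
move=> /andP[? ?]; nra.
Qed.

(** Compactness in near-covering form makes the local scale uniform: half of the local radius pays
    for moving the centre, half for the second point, which may leave the segment. *)
Lemma compact_modulus (R : realType) (f : R -> R) (a b e : R) :
  continuous f -> 0 < e ->
  exists2 h, 0 < h & forall x y, a <= x <= b -> `|x - y| <= h -> `|f x - f y| <= e.
Proof.
move=> cf e0.
have /compact_near_coveringP cov := @segment_compact R a b.
pose good (h x : R) := forall y, `|x - y| <= h -> `|f x - f y| <= e.
have local x : `[a, b]%classic x -> \forall x' \near x & h \near 0^'+, good h x'.
  move=> _.
  have e2 : 0 < e / 2 by lra.
  have [r /= r0 fr] : exists2 r, 0 < r & forall y, `|x - y| < r -> `|f x - f y| < e / 2.
    have /cvgrPdist_lt/(_ _ e2)/nbhs_ballP[r /= r0 br] := cf x.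
    by exists r => // y xy; apply: br.
  exists (ball x (r / 2), [set h | 0 < h < r / 2]) => /=; first split.
  - by apply: nbhsx_ballx; lra.
  - near=> h; apply/andP; split; near: h; [exact: nbhs_right_gt|].
    by apply: nbhs_right_lt; lra.
  - move=> [y h] /= [xy /andP[h0 hr]] z yz.
    have := fr y; have := fr z.
    have xz : `|x - z| < r.
      rewrite (_ : x - z = (x - y) + (y - z)); last ring.
      by rewrite (le_lt_trans (ler_normD _ _)) //; rewrite /ball /= in xy; lra.
    move=> /(_ xz) xz' /(_ _) xy'.
    rewrite (_ : f y - f z = (f x - f z) - (f x - f y)); last ring.
    rewrite (le_trans (ler_normB _ _)) //.
    have : `|x - y| < r by rewrite /ball /= in xy; lra.
    by move/xy'; lra.
have hP := cov R _ _ (at_right_proper_filter _) local.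
have gt0 : (0 : R)^'+ [set k | 0 < k] by exact: nbhs_right_gt.
have [k [k0 kP]] := filter_ex (filterI gt0 hP).
exists k => // x y xab; apply: kP; rewrite /= in_itv; exact: xab.
Unshelve. all: by end_near. Qed.

Lemma quad_approximation (R : realType) (f : R -> R) (F e : R) :
  continuous f -> (forall x, `|f x| <= F) -> 0 < e ->
  exists q C M, quad_taylor q C M /\ forall x, `|f x - q x| <= e * (1 + x ^+ 2).
Proof.
move=> cf fF e0.
have F0 : 0 <= F by apply: le_trans (fF 0).
(* Beyond distance [L] the crude bound |f - q| <= 2 F is at most e L, and L <= |x| <= x^2 because L
   >= 1. *)
pose L := 2 * F / e + 1.
have L1 : 1 <= L by rewrite lerDr divr_ge0 ?mulr_ge0 // ltW.
have eL : 2 * F <= e * L by rewrite /L mulrDr mulr1 [e * _]mulrC divfK ?gt_eqF // lerDl ltW.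
have [h h0 fh] := compact_modulus (- L) (L + 1) cf e0.
pose h' := Num.min h 1.
have h'0 : 0 < h' by rewrite /h' lt_min h0 ltr01.
have [h'h h'1] : h' <= h /\ h' <= 1 by split; rewrite /h' ge_min lexx ?orbT.
(* The grid must reach [L] and stop before [L + 1], where the modulus of continuity ends; a mesh of
   at most 1 keeps the overshoot within that margin. *)
have [m [mL mL1]] : exists m : nat, L <= - L + m%:R * h' /\ - L + m%:R * h' <= L + 1.
  exists (Num.truncn (2 * L / h')).+1.
  have q0 : 0 <= 2 * L / h' by rewrite divr_ge0 ?ltW //; lra.
  have /andP[] := truncn_itv q0.
  rewrite -natr1 ler_pdivlMr // ltr_pdivrMr // => ? ?.
  by split; lra.
have [|q [C [M [qt qF _ qf]]]] := @quad_interpolation R f F (- L) h' e m fF h'0.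
  move=> x y /andP[Lx xL] xy; apply: fh; first by rewrite Lx (le_trans xL).
  exact: le_trans h'h.
exists q, C, M; split=> // x.
have [xL|xL] := boolP (- L <= x <= - L + m%:R * h').
  by rewrite distrC (le_trans (qf _ xL)) // ler_pMr // lerDl sqr_ge0.
have x2 : L <= x ^+ 2.
  have : L <= `|x|.
    rewrite negb_and -!ltNge in xL; rewrite ler_normr; apply/orP.
    by case/orP: xL => ?; [right|left]; lra.
  move=> Lx; rewrite -real_normK ?num_real // expr2; apply: (le_trans Lx).
  exact: ler_peMr (normr_ge0 _) (le_trans L1 Lx).
rewrite (le_trans (ler_normB _ _)) //.
have := fF x; have := qF x.
have : e * L <= e * (1 + x ^+ 2) by rewrite ler_wpM2l ?ltW //; lra.
lra.
Qed.

(** * Upper bounds on means of nonnegative random variables *)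

(** Measurability and nonnegativity travel with the bound, so that estimates can be added, scaled
    and compared without separate integrability arguments. *)
Definition mean_le (d : measure_display) (T : measurableType d) (R : realType)
    (P : probability T R) (h : T -> R) (U : R) : Prop :=
  [/\ measurable_fun setT h, (forall w, 0 <= h w) &
      (\int[P]_w (h w)%:E <= U%:E)%E].

Section mean_le_theory.
Context {d : measure_display} {T : measurableType d} {R : realType}.
Context (P : probability T R).
Implicit Types (h k : T -> R) (U V : R).

Lemma mean_le_bound h U V : mean_le P h U -> U <= V -> mean_le P h V.
Proof.
move=> [mh h0 hU] UV; split=> //; apply: le_trans hU _.
by rewrite lee_fin.
Qed.

Lemma mean_le_cst U : 0 <= U -> mean_le P (fun=> U) U.
Proof.
move=> U0; split=> //.
rewrite integral_cst //.
by rewrite -[leRHS]mule1 lee_wpmul2l ?lee_fin //; exact: probability_le1.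
Qed.

Lemma mean_leD h k U V : mean_le P h U -> mean_le P k V ->
  mean_le P (fun w => h w + k w) (U + V).
Proof.
move=> [mh h0 hU] [mk k0 kV]; split; first exact: measurable_funD.
  by move=> w; rewrite addr_ge0.
under eq_integral do rewrite EFinD.
rewrite ge0_integralD //; first by rewrite EFinD leeD.
- by move=> w _; rewrite lee_fin.
- exact/measurable_EFinP.
- by move=> w _; rewrite lee_fin.
- exact/measurable_EFinP.
Qed.

Lemma mean_leZ h U a : 0 <= a -> mean_le P h U ->
  mean_le P (fun w => a * h w) (a * U).
Proof.
move=> a0 [mh h0 hU]; split; first exact: measurable_funM.
  by move=> w; rewrite mulr_ge0.
under eq_integral do rewrite EFinM.
rewrite ge0_integralZl_EFin //; first by rewrite EFinM lee_wpmul2l ?lee_fin.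
- by move=> w _; rewrite lee_fin.
- exact/measurable_EFinP.
Qed.

Lemma mean_le_sum (I : finType) (h : I -> T -> R) U :
  (forall i, mean_le P (h i) U) ->
  mean_le P (fun w => \sum_i h i w) (#|I|%:R * U).
Proof.
move=> hU; rewrite cardE mulr_natl.
have -> : (fun w => \sum_i h i w) = (fun w => \sum_(i <- enum I) h i w).
  by apply/funext => w; rewrite big_enum.
elim: (enum I) => [|i s IHs].
  have -> : (fun w => \sum_(i <- [::]) h i w) = (fun=> 0).
    by apply/funext => w; rewrite big_nil.
  by rewrite mulr0n; apply: mean_le_cst.
have -> : (fun w => \sum_(i <- i :: s) h i w) =
    (fun w => h i w + \sum_(i <- s) h i w).
  by apply/funext => w; rewrite big_cons.
by rewrite /= mulrS; apply: mean_leD.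
Qed.

Lemma mean_le_dominated h k U : measurable_fun setT h -> (forall w, 0 <= h w) ->
  (forall w, h w <= k w) -> mean_le P k U -> mean_le P h U.
Proof.
move=> mh h0 hk [mk k0 kU]; split=> //; apply: le_trans _ kU.
apply: ge0_le_integral => //.
- by move=> w _; rewrite lee_fin.
- exact/measurable_EFinP.
- exact/measurable_EFinP.
- by move=> w _; rewrite lee_fin.
Qed.

Lemma mean_le_markov h U a : 0 < a -> mean_le P h U ->
  (P [set w | (a < h w)%R] <= (U / a)%:E)%E.
Proof.
move=> a0 [mh h0 hU].
have mA : measurable [set w | (a < h w)%R].
  rewrite (_ : [set w | (a < h w)%R] = h @^-1` `]a, +oo[%classic).
    by rewrite -[X in measurable X]setTI; apply: mh.
  by apply/seteqP; split=> w /=; rewrite in_itv /= andbT.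
have : (a%:E * P [set w | (a < h w)%R] <= U%:E)%E.
  apply: le_trans _ hU.
  rewrite -[X in P X]setIT -integral_indic // -ge0_integralZl_EFin ?(ltW a0) //.
  - apply: ge0_le_integral => //.
    + by move=> w _; rewrite mule_ge0 ?lee_fin ?(ltW a0).
    + apply/measurable_EFinP/measurable_funM => //; exact: measurable_indic.
    + exact/measurable_EFinP.
    + move=> w _; rewrite indicE; have [|_] := boolP (w \in _).
        by rewrite inE /= mule1 lee_fin => /ltW.
      by rewrite mule0 lee_fin.
  - by apply/measurable_EFinP; exact: measurable_indic.
by rewrite muleC EFinM -lee_pdivlMr.
Qed.

Section finite_valued.
Context {F : finType} {z : T -> F} (mz : forall u, measurable (z @^-1` [set u])).

Lemma measurable_finite_comp (phi : F -> R) : measurable_fun setT (phi \o z).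
Proof.
move=> _ Y _; rewrite setTI comp_preimage.
have -> : z @^-1` (phi @^-1` Y) = \bigcup_(u in phi @^-1` Y) z @^-1` [set u].
  apply/seteqP; split=> [w Yw|w [u Yu zu]]; first by exists (z w).
  by move: zu Yu; rewrite /preimage /= => ->.
apply: fin_bigcup_measurable; last by move=> u _; exact: mz.
exact: finite_finset.
Qed.

Lemma integral_finite (phi : F -> R) : (forall u, 0 <= phi u) ->
  (\int[P]_w ((phi \o z) w)%:E =
   (\sum_u fine (P (z @^-1` [set u])) * phi u)%:E)%E.
Proof.
move=> phi0.
have -> : (\int[P]_w ((phi \o z) w)%:E =
    \int[P]_w \sum_u (phi u)%:E * (\1_(z @^-1` [set u]) w)%:E)%E.
  apply: eq_integral => w _; rewrite (bigD1 (z w)) //= big1 ?adde0.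
    by rewrite indicE mem_set //= mule1.
  move=> u uz; rewrite indicE memNset ?mule0 //= => zu.
  by rewrite zu eqxx in uz.
rewrite ge0_integral_sum //.
- rewrite -sumEFin; apply: eq_bigr => u _.
  rewrite ge0_integralZl_EFin //; last first.
    by apply/measurable_EFinP; exact: measurable_indic.
  by rewrite integral_indic // setIT muleC EFinM fineK ?fin_num_measure.
- by move=> u; apply/measurable_EFinP/measurable_funM.
- by move=> u w _; rewrite mule_ge0 ?lee_fin.
Qed.

Lemma mean_le_finite (phi : F -> R) : (forall u, 0 <= phi u) ->
  mean_le P (phi \o z) (\sum_u fine (P (z @^-1` [set u])) * phi u).
Proof.
move=> phi0; split; first exact: measurable_finite_comp.
  by move=> w; exact: phi0.
by rewrite integral_finite.
Qed.

Lemma sum_fiber_probability : \sum_u fine (P (z @^-1` [set u])) = 1.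
Proof.
have PT : P [set: T] = 1%E by exact: probability_setT.
have E : (\int[P]_w (cst 1%E w) =
    (\sum_u fine (P (z @^-1` [set u])) * 1)%:E)%E.
  exact: (@integral_finite (fun=> 1) (fun=> ler01)).
move: E; rewrite integral_cst // mul1e => /(etrans (esym PT)) [->].
by apply: eq_bigr => u _; rewrite mulr1.
Qed.

End finite_valued.
End mean_le_theory.

(** * Rounded entries and the variance of their eigenvalue sum *)

(** [-K, K] is cut into cells of width [e], each represented by its left endpoint. The last index is
    an overflow state of value 0 for everything outside. *)
Lemma rounding (R : realType) (K e : R) : 0 <= K -> 0 < e ->
  exists (m : nat) (idx : R -> 'I_m.+1) (val : 'I_m.+1 -> R),
    [/\ forall i, measurable (idx @^-1` [set i]), forall i, `|val i| <= K,
        forall x, `|x| <= K -> `|val (idx x) - x| <= e &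
        forall x, K < `|x| -> val (idx x) = 0].
Proof.
(* The successor keeps every cell index strictly below [m], so that [ord_max] is free for the
   overflow. *)
move=> K0 e0; pose m := (Num.truncn (2 * K / e)).+1.
pose idx x : 'I_m.+1 :=
  if `|x| <= K then inord (Num.truncn ((x + K) / e)) else ord_max.
pose val (i : 'I_m.+1) := if i == ord_max then 0 else i%:R * e - K.
have q0 : 0 <= 2 * K / e by rewrite divr_ge0 ?mulr_ge0 // ltW.
have /andP[qlo qhi] := truncn_itv q0.
have pos x : `|x| <= K -> 0 <= (x + K) / e.
  by rewrite ler_norml => /andP[? ?]; apply: divr_ge0; [lra|exact: ltW].
have small x : `|x| <= K -> (Num.truncn ((x + K) / e) < m)%N.
  move=> xK; have /andP[xlo _] := truncn_itv (pos _ xK).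
  rewrite -(@ltr_nat R); apply: (le_lt_trans xlo); apply: le_lt_trans qhi.
  by rewrite ler_pM2r ?invr_gt0 //; move: xK; rewrite ler_norml => /andP[? ?]; lra.
have idxE x : `|x| <= K -> idx x = Num.truncn ((x + K) / e) :> nat.
  by move=> xK; rewrite /idx xK inordK // ltnS ltnW // small.
have idx_max x : (idx x == ord_max) = (K < `|x|).
  rewrite ltNge; have [xK|xK] := boolP (`|x| <= K); last by rewrite /idx (negPf xK) eqxx.
  by apply/negbTE; rewrite -val_eqE /= idxE // neq_ltn small.
exists m, idx, val; split.
- move=> i; have [->|im] := eqVneq i ord_max.
    rewrite (_ : _ @^-1` _ = ~` `[- K, K]%classic).
      by apply: measurableC.
    apply/seteqP; split=> x /=; rewrite in_itv /= -ler_norml.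
      by move/eqP; rewrite idx_max ltNge => /negP.
    by move/negP; rewrite -ltNge -idx_max => /eqP.
  rewrite (_ : _ @^-1` _ = `[- K, K]%classic `&`
      `[i%:R * e - K, i.+1%:R * e - K[%classic).
    exact: measurableI.
  apply/seteqP; split=> x /=; rewrite !in_itv /= -ler_norml.
    move=> xi; have xK : `|x| <= K by rewrite leNgt -idx_max xi.
    split=> //; have /andP[] := truncn_itv (pos _ xK).
    rewrite -idxE // xi ler_pdivlMr // ltr_pdivrMr // => ? ?.
    by apply/andP; split; lra.
  move=> [xK /andP[lo hi]]; apply: val_inj; rewrite /= idxE //; apply/eqP.
  rewrite Num.Theory.truncn_eq ?pos //.
  rewrite ler_pdivlMr // ltr_pdivrMr //; apply/andP; split; lra.
- move=> i; rewrite /val; case: eqVneq => im; first by rewrite normr0.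
  have il : (i <= Num.truncn (2 * K / e))%N.
    have := ltn_ord i; rewrite ltnS leq_eqVlt => /orP[/eqP ie|//].
    by case/eqP: im; exact: val_inj.
  have : i%:R * e <= 2 * K.
    rewrite -ler_pdivlMr //; apply: le_trans qlo; by rewrite ler_nat.
  have : 0 <= i%:R * e by rewrite mulr_ge0 ?(ltW e0).
  by rewrite ler_norml => ? ?; apply/andP; split; lra.
- move=> x xK; rewrite /val idx_max ltNge xK /= idxE //.
  have /andP[] := truncn_itv (pos _ xK).
  rewrite -natr1 ler_pdivlMr // ltr_pdivrMr // => ? ?.
  by rewrite ler_norml; apply/andP; split; lra.
- by move=> x; rewrite -idx_max /val => ->.
Qed.

Section block_rounding.
Context {d : measure_display} {T : measurableType d} {R : realType}.
Context (P : probability T R) (n : nat) (X : 'I_n -> 'I_n -> {RV P >-> R}).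
Context (Pi : {set {set 'I_n * 'I_n}}) (m : nat) (idx : R -> 'I_m.+1).
Context (val : 'I_m.+1 -> R).
Context (Xsym : forall w, (random_mx X w)^T = random_mx X w).
Context (Pi_partition : finset.partition Pi (upper_triangle n)).
Context (Pi_independent :
  independent_family P Pi (fun B => block_vector X B)).
Context (midx : forall i, measurable (idx @^-1` [set i])).

Local Notation state := {ffun 'I_n * 'I_n -> 'I_m.+1}.

(** The Efron-Stein inequality uses one value type for all coordinates, so the states of a block are
    extended by [ord0] to the full index set. *)
Definition tuple_state (B : {set 'I_n * 'I_n}) (t : #|B|.-tuple R) : state :=
  [ffun p => if [pick k | enum_val k == p] is Some k then idx (tnth t k)
             else ord0].

Lemma measurable_tuple_state B v : measurable (@tuple_state B @^-1` [set v]).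
Proof.
have -> : @tuple_state B @^-1` [set v] =
    \bigcap_(p in [set: 'I_n * 'I_n]) [set t | tuple_state t p = v p].
  apply/seteqP; split=> [t /= <- //|t tv] /=.
  by apply/ffunP => p; exact: tv.
apply: fin_bigcap_measurable; first exact: finite_finset.
move=> p _; rewrite /tuple_state.
case E : [pick k | enum_val k == p] => [k|].
  have -> : [set t : #|B|.-tuple R | [ffun p => if [pick k | enum_val k == p]
      is Some k then idx (tnth t k) else ord0] p = v p] =
      (fun t : #|B|.-tuple R => tnth t k) @^-1` (idx @^-1` [set v p]).
    by apply/seteqP; split=> t /=; rewrite ffunE E.
  rewrite -[X in measurable X]setTI; exact: measurable_tnth.
have [v0|v0] := eqVneq (ord0 : 'I_m.+1) (v p).
  rewrite (_ : mkset _ = setT) //.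
  by apply/seteqP; split=> t //= _; rewrite ffunE E.
rewrite (_ : mkset _ = set0) //.
by apply/seteqP; split=> t //=; rewrite ffunE E => v0'; rewrite v0' eqxx in v0.
Qed.

(** Sets outside [Pi] receive a constant state, which allows the product to be indexed by all sets
    of positions. *)
Definition block_states (w : T) : {ffun {set 'I_n * 'I_n} -> state} :=
  [ffun B => if B \in Pi then tuple_state (block_vector X B w)
             else [ffun=> ord0]].

(** Reading both mirror entries from the same coordinate makes the matrix symmetric for every [u],
    including those that no sample point attains. *)
Definition state_mx (u : {ffun {set 'I_n * 'I_n} -> state}) : 'M[R]_n :=
  \matrix_(i, j) let p := upper_index (i, j) in
                 val (u (finset.pblock Pi p) p).

Definition block_law (B : {set 'I_n * 'I_n}) (v : state) : R :=
  fine (P [set w | block_states w B = v]).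

Lemma block_index (p : 'I_n * 'I_n) :
  finset.pblock Pi (upper_index p) \in Pi /\
  upper_index p \in finset.pblock Pi (upper_index p).
Proof.
case/and3P: Pi_partition => /eqP cov _ _.
split; first by rewrite finset.pblock_mem // cov upper_index_upper.
by rewrite finset.mem_pblock cov upper_index_upper.
Qed.

Lemma state_mx_block_states w :
  state_mx (block_states w) = \matrix_(i, j) val (idx (X i j w)).
Proof.
have Xs i j : X j i w = X i j w.
  by have /matrixP/(_ i j) := Xsym w; rewrite !mxE.
apply/matrixP => i j; rewrite !mxE /=.
have [pPi pB] := block_index (i, j).
rewrite ffunE pPi ffunE; case: pickP => [k /eqP kp|/(_ (enum_rank_in pB _))].
  rewrite tnth_mktuple kp /upper_index /=; case: ifP => //= _.
  by rewrite Xs.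
by move=> /(_ (upper_index (i, j))); rewrite enum_rankK_in // eqxx.
Qed.

Lemma state_mx_sym u : (state_mx u)^T = state_mx u.
Proof. by apply/matrixP => i j; rewrite !mxE upper_index_sym. Qed.

Lemma measurable_block_state B v :
  measurable [set w | block_states w B = v].
Proof.
have [BPi|BPi] := boolP (B \in Pi).
  have -> : [set w | block_states w B = v] =
      block_vector X B @^-1` (@tuple_state B @^-1` [set v]).
    by apply/seteqP; split=> w /=; rewrite ffunE BPi.
  rewrite -[X in measurable X]setTI.
  have mB : measurable_fun setT (block_vector X B).
    apply/measurable_fun_tnthP => k.
    rewrite (_ : _ \o _ = X (enum_val k).1 (enum_val k).2) //.
    by apply/funext => w /=; rewrite tnth_mktuple.
  by apply: mB => //; exact: measurable_tuple_state.
have [v0|v0] := eqVneq [ffun=> ord0] v.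
  rewrite (_ : mkset _ = setT) //.
  by apply/seteqP; split=> w //= _; rewrite ffunE (negPf BPi).
rewrite (_ : mkset _ = set0) //.
apply/seteqP; split=> w //=; rewrite ffunE (negPf BPi) => v0'.
by rewrite v0' eqxx in v0.
Qed.

Lemma block_states_fiber u :
  block_states @^-1` [set u] = \bigcap_(B in setT) [set w | block_states w B = u B].
Proof.
apply/seteqP; split=> [w /= <- //|w wu] /=.
by apply/ffunP => B; exact: wu.
Qed.

Lemma measurable_block_states u : measurable (block_states @^-1` [set u]).
Proof.
rewrite block_states_fiber; apply: fin_bigcap_measurable.
  exact: finite_finset.
by move=> B _; exact: measurable_block_state.
Qed.

Lemma block_law_ge0 B v : 0 <= block_law B v.
Proof. by rewrite fine_ge0 // measure_ge0. Qed.

Lemma block_law_sum B : \sum_v block_law B v = 1.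
Proof.
exact: (sum_fiber_probability P (z := fun w => block_states w B)
  (measurable_block_state B)).
Qed.

(** Independence of the blocks gives the product over [Pi]. A set outside [Pi] contributes the
    factor 1 if its state is the default, and otherwise both sides vanish. *)
Lemma block_states_law u :
  fine (P (block_states @^-1` [set u])) = product_weight block_law u.
Proof.
have fP A : measurable A -> (fine (P A))%:E = P A.
  by move=> mA; rewrite fineK // fin_num_measure.
have [/existsP[B /andP[BPi uB]]|/existsPn u0] :=
    boolP [exists B, (B \notin Pi) && (u B != [ffun=> ord0])].
  rewrite /product_weight (bigD1 B) //= /block_law.
  rewrite (_ : mkset _ = set0) ?measure0 ?mul0r.
    rewrite (_ : _ @^-1` _ = set0) ?measure0 //.
    apply/seteqP; split=> w //= wu; move: uB.
    by rewrite -wu ffunE (negPf BPi) eqxx.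
  apply/seteqP; split=> w //= wu; move: uB.
  by rewrite -wu ffunE (negPf BPi) eqxx.
have out B : B \notin Pi -> u B = [ffun=> ord0].
  by move=> BPi; apply/eqP; have := u0 B; rewrite BPi /= negbK.
apply: EFin_inj; rewrite fP; last exact: measurable_block_states.
rewrite /product_weight (bigID (mem Pi)) /= [X in _ * X]big1 ?mulr1; last first.
  move=> B BPi; rewrite /block_law (_ : mkset _ = setT).
    by rewrite (_ : P setT = 1%E) //; exact: probability_setT.
  by apply/seteqP; split=> w //= _; rewrite ffunE (negPf BPi) out.
have -> : block_states @^-1` [set u] =
    \bigcap_(B in [set` Pi])
      (block_vector X B @^-1` (@tuple_state B @^-1` [set u B])).
  rewrite block_states_fiber; apply/seteqP; split=> w wu B /= BPi.
    by have := wu B I; rewrite /= ffunE BPi.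
  rewrite ffunE; have [BPi'|BPi'] := boolP (B \in Pi); last by rewrite out.
  exact: wu.
rewrite Pi_independent //; last by move=> B _; exact: measurable_tuple_state.
rewrite -prodEFin; apply: eq_bigr => B BPi.
rewrite /block_law fP; last exact: measurable_block_state.
by congr (P _); apply/seteqP; split=> w /=; rewrite ffunE BPi.
Qed.

Lemma state_mx_update u (B : {set 'I_n * 'I_n}) (v : state) (i j : 'I_n) :
  upper_index (i, j) \notin B -> state_mx (update u B v) i j = state_mx u i j.
Proof.
move=> pB; rewrite !mxE /update /= ffunE; case: eqP => // BE.
by have [_] := block_index (i, j); rewrite BE (negPf pB).
Qed.

Lemma erase_block_update u (B : {set 'I_n * 'I_n}) (v : state) :
  erase_block B (state_mx (update u B v)) = erase_block B (state_mx u).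
Proof.
apply/matrixP => i j; rewrite [LHS]mxE [RHS]mxE.
by case: ifPn => // /state_mx_update ->.
Qed.

Lemma state_mx_update_out u (B : {set 'I_n * 'I_n}) (v : state) :
  B \notin Pi -> state_mx (update u B v) = state_mx u.
Proof.
move=> BPi; apply/matrixP => i j; rewrite !mxE /update /= ffunE.
case: eqP => // BE.
by have [pPi _] := block_index (i, j); rewrite BE (negPf BPi) in pPi.
Qed.

(** The influence bound holds at every point of the product space, so averaging it against weights
    of total mass 1 leaves it unchanged. *)
Lemma block_rounding_variance (q : R -> R) (C M D k : R) :
  (forall B, B \in Pi -> #|B|%:R <= D) -> 0 <= D -> quad_taylor q C M ->
  (forall i, val i ^+ 2 <= k) ->
  exists c, mean_le P
    (fun w => (eigensum q (\matrix_(i, j) val (idx (X i j w))) - c) ^+ 2)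
    (4 * D * k * n%:R * M ^+ 2 + 4 * C ^+ 2 * D * k ^+ 2 * n%:R ^+ 2).
Proof.
move=> cardB D0 qt valk; pose V := 4 * D * k * n%:R * M ^+ 2 + 4 * C ^+ 2 * D * k ^+ 2 * n%:R ^+ 2.
pose g u := eigensum q (state_mx u).
(* For a set outside [Pi] the function [g] itself ignores the coordinate, and the corresponding
   Efron-Stein term is zero. *)
pose gs B u := if B \in Pi then eigensum q (erase_block B (state_mx u)) else g u.
have [|c gc] := @efron_stein R _ _ block_law g gs [ffun=> [ffun=> ord0]]
    block_law_ge0 block_law_sum.
  move=> B u v; rewrite /gs; have [BPi|BPi] := boolP (B \in Pi).
    by rewrite erase_block_update.
  by rewrite /g state_mx_update_out.
exists c.
have -> : (fun w => (eigensum q (\matrix_(i, j) val (idx (X i j w))) - c) ^+ 2) =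
    (fun u => (g u - c) ^+ 2) \o block_states.
  by apply/funext => w; rewrite /= /g state_mx_block_states.
apply: mean_le_bound (mean_le_finite _ measurable_block_states _) _.
  by move=> u; exact: sqr_ge0.
under eq_bigr do rewrite block_states_law.
apply: le_trans gc _; rewrite exchange_big /=.
have step u : \sum_B product_weight block_law u * (g u - gs B u) ^+ 2 <=
    product_weight block_law u * V.
  rewrite -mulr_sumr ler_wpM2l //.
    by apply: prodr_ge0 => B _; exact: block_law_ge0.
  rewrite (bigID (mem Pi)) /= [X in _ + X]big1 ?addr0; last first.
    by move=> B BPi; rewrite /gs (negPf BPi) subrr expr0n.
  apply: le_trans (block_influence Pi_partition cardB D0 qt (state_mx_sym u) _).
    by rewrite le_eqVlt; apply/orP; left; apply/eqP/eq_bigr => B BPi;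
      rewrite /gs BPi.
  by move=> i j; rewrite mxE.
apply: le_trans (ler_sum _ (fun u _ => step u)) _.
rewrite -mulr_suml -[leRHS]mul1r le_eqVlt; apply/orP; left; apply/eqP.
congr (_ * _); rewrite -(sum_fiber_probability P measurable_block_states).
by apply: eq_bigr => u _; rewrite block_states_law.
Qed.
End block_rounding.

(** * Measurability of eigenvalue sums and integrals against the spectral distribution *)

(** [f] is exchanged for its smooth approximation at both matrices, with an error controlled by
    their Hilbert-Schmidt norms; between them the Taylor bound applies. *)
Lemma eigensum_continuous (R : realType) n (f : R -> R) (F e : R) (A : 'M[R]_n) :
  continuous f -> (forall x, `|f x| <= F) -> A^T = A -> 0 < e ->
  exists2 r, 0 < r & forall A' : 'M[R]_n, A'^T = A' ->
    (forall i j, `|A' i j - A i j| <= r) ->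
    `|eigensum f A' - eigensum f A| <= e.
Proof.
move=> cf fF symA e0.
have lin1 (x y z u v : R) : u <= 2 * y + 2 * v -> v <= z ->
    x + y + (x + u) <= 2 * x + 3 * y + 2 * z + 1 by lra.
have lin2 (a b a' b' g x x' y y' z : R) : `|a - b| <= x -> `|a' - b'| <= x' ->
    `|b' - b - g| <= y -> `|g| <= z -> x + x' <= e / 2 -> y <= y' ->
    z + y' <= e / 2 -> `|a' - a| <= e.
  rewrite !ler_norml => /andP[? ?] /andP[? ?] /andP[? ?] /andP[? ?] ? ? ?.
  by apply/andP; split; lra.
pose H := entry_dot A A; pose c : R := #|{: 'I_n * 'I_n}|%:R.
have H0 : 0 <= H by exact: entry_dot_ge0.
have c0 : 0 <= c by [].
(* For r <= 1 the two approximation errors carry the factor (n + H) + (n + 2 H + 2 c); the extra 1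
   keeps the denominator positive. *)
pose e1 := e / (2 * (2 * n%:R + 3 * H + 2 * c + 1)).
have den0 : 0 < 2 * (2 * n%:R + 3 * H + 2 * c + 1).
  by have := ler0n R n; lra.
have e10 : 0 < e1 by rewrite divr_gt0.
have e1E : e1 * (2 * n%:R + 3 * H + 2 * c + 1) = e / 2.
  by rewrite /e1; field; rewrite gt_eqF //; have := ler0n R n; lra.
have [q [C [M [qt fq]]]] := quad_approximation cf fF e10.
have [C0 M0] := quad_taylor_ge0 qt.
have [G [_ GT]] := eigensum_taylor qt symA.
pose g := \sum_p `|G p.1 p.2|.
have g0 : 0 <= g by apply: sumr_ge0.
have s0 : 0 < 2 * (g + C * c + 1) by have := mulr_ge0 C0 c0; lra.
pose r := Num.min 1 (e / (2 * (g + C * c + 1))).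
have r0 : 0 < r by rewrite /r lt_min ltr01 divr_gt0.
have r1 : r <= 1 by rewrite /r ge_min lexx.
have rE : r * (g + C * c) <= e / 2.
  have : r <= e / (2 * (g + C * c + 1)) by rewrite /r ge_min lexx orbT.
  rewrite ler_pdivlMr // => h.
  have := mulr_ge0 C0 c0; nra.
exists r => // A' symA' AA'.
have D_le : entry_dot (A' - A) (A' - A) <= c * r ^+ 2.
  rewrite /c mulr_natl -sumr_const; apply: ler_sum => p _.
  by rewrite -expr2 !mxE -real_normK ?num_real // lerXn2r ?nnegrE ?(ltW r0).
have D_le1 : c * r ^+ 2 <= c * r.
  by rewrite ler_wpM2l // expr2 ler_piMr // ltW.
have G_le : `|entry_dot G (A' - A)| <= r * g.
  apply: (le_trans (ler_norm_sum _ _ _)); rewrite /g mulr_sumr.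
  apply: ler_sum => p _; rewrite normrM mulrC ler_wpM2r //.
  by rewrite !mxE AA'.
have A'_le : entry_dot A' A' <= 2 * H + 2 * (c * r).
  apply: (@le_trans _ _ (2 * H + 2 * entry_dot (A' - A) (A' - A))); last by lra.
  rewrite /H /entry_dot !mulr_sumr -big_split; apply: ler_sum => p _ /=.
  (* a'^2 <= 2 a^2 + 2 (a' - a)^2, the difference being (a' - 2 a)^2. *)
  rewrite !mxE; have := sqr_ge0 (A' p.1 p.2 - 2 * A p.1 p.2); nra.
have h1 := eigensum_dist fq symA.
have h2 := eigensum_dist fq symA'.
have h3 := GT _ symA'.
have cr : c * r <= c by rewrite ler_piMr.
have h4 : e1 * (n%:R + H) + e1 * (n%:R + entry_dot A' A') <= e / 2.
  by rewrite -e1E -mulrDr; apply: ler_wpM2l (ltW e10) _ _ (lin1 _ _ _ _ _ A'_le cr).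
have h5 : C * entry_dot (A' - A) (A' - A) <= r * (C * c).
  by rewrite mulrCA ler_wpM2l // [r * c]mulrC (le_trans D_le D_le1).
rewrite mulrDr in rE; exact: lin2 h1 h2 h3 G_le h4 h5 rE.
Qed.

Section eigensum_measurable.
Context {d : measure_display} {T : measurableType d} {R : realType}.
Context (P : probability T R) (n : nat) (X : 'I_n -> 'I_n -> {RV P >-> R}).

Lemma measurable_rounded m (idx : R -> 'I_m.+1) (phi : 'M['I_m.+1]_n -> R) :
  (forall i, measurable (idx @^-1` [set i])) ->
  measurable_fun setT (fun w => phi (\matrix_(i, j) idx (X i j w))).
Proof.
move=> midx.
apply: (measurable_finite_comp (z := fun w => \matrix_(i, j) idx (X i j w))).
move=> u.
have -> : (fun w => \matrix_(i, j) idx (X i j w)) @^-1` [set u] =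
    \bigcap_(p in [set: 'I_n * 'I_n])
      (X p.1 p.2 @^-1` (idx @^-1` [set u p.1 p.2])).
  apply/seteqP; split=> [w /= <- p _|w wu] /=; first by rewrite mxE.
  by apply/matrixP => i j; rewrite mxE; exact: (wu (i, j)).
apply: fin_bigcap_measurable; first exact: finite_finset.
move=> p _; rewrite -[X in measurable X]setTI.
exact: (measurable_funPT (X p.1 p.2)).
Qed.

(** Pointwise limit of functions of finitely valued matrices: level k truncates at k and rounds with
    mesh 1/(k+1). At a fixed sample point the truncation is eventually inactive, and continuity of
    the eigenvalue sum does the rest. *)
Lemma measurable_eigensum (f : R -> R) (F : R) :
  (forall w, (random_mx X w)^T = random_mx X w) ->
  continuous f -> (forall x, `|f x| <= F) ->
  measurable_fun setT (fun w => eigensum f (random_mx X w)).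
Proof.
move=> Xsym cf fF.
have Xs w i j : X j i w = X i j w.
  by have /matrixP/(_ i j) := Xsym w; rewrite !mxE.
have /choice[h hP] : forall k : nat, exists h : T -> R,
    measurable_fun setT h /\ forall w, (forall i j, `|X i j w| <= k%:R) ->
    exists A' : 'M[R]_n, [/\ A'^T = A', h w = eigensum f A' &
      forall i j, `|A' i j - random_mx X w i j| <= k.+1%:R^-1].
  move=> k; have k0 : 0 < k.+1%:R^-1 :> R by rewrite invr_gt0.
  have [m [idx [val [midx _ valP _]]]] := rounding (ler0n R k) k0.
  exists (fun w => eigensum f (map_mx val (\matrix_(i, j) idx (X i j w)))).
  split; first exact: (measurable_rounded (fun u => eigensum f (map_mx val u))).
  move=> w wk; exists (map_mx val (\matrix_(i, j) idx (X i j w))); split=> //.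
    by apply/matrixP => i j; rewrite !mxE Xs.
  by move=> i j; rewrite !mxE valP.
apply: (measurable_fun_cvg (h := h)) => [k|w _]; first by have [] := hP k.
apply/cvgrPdist_le => e e0.
have [r r0 rP] := eigensum_continuous cf fF (Xsym w) e0.
pose B := \sum_p `|X p.1 p.2 w|.
have XB i j : `|X i j w| <= B.
  by rewrite /B (bigD1 (i, j)) //= lerDl sumr_ge0.
near=> k; have [_ /(_ w)[|A' [symA' -> A'k]]] := hP k.
  move=> i j; apply: le_trans (XB i j) _; near: k; exact: nbhs_infty_ger.
rewrite distrC; apply: rP => // i j; apply: le_trans (A'k i j) _.
near: k; have [N _ NP] := near_infty_natSinv_lt (PosNum r0).
by exists N => // k Nk; apply/ltW; exact: NP.
Unshelve. all: by end_near. Qed.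

End eigensum_measurable.

Lemma Rintegral_esd (R : realType) n (A : 'M[R]_n) (f : R -> R) :
  measurable_fun setT f ->
  (\int[esd A]_x f x)%R = n%:R^-1 * eigensum f A.
Proof.
move=> mf.
have int_ge0 (g : R -> \bar R) : measurable_fun setT g -> (forall x, (0 <= g x)%E) ->
    (\int[esd A]_x g x = (n%:R^-1)%:E * \sum_(j < n) g (eigenvalues A)`_j)%E.
  move=> mg g0; rewrite /esd ge0_integral_mscale //=; congr (_ * _)%E.
  rewrite ge0_integral_measure_sum //; apply: eq_bigr => j _.
  by rewrite integral_dirac // diracT mul1e.
have mEf : measurable_fun setT (EFin \o f) by exact/measurable_EFinP.
rewrite /Rintegral integralE !int_ge0 //.
- have posE x : ((EFin \o f)^\+ x)%E = (Num.max (f x) 0)%:E.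
    by rewrite funeposE /= EFin_max.
  have negE x : ((EFin \o f)^\- x)%E = (Num.max (- f x) 0)%:E.
    by rewrite funenegE /= EFin_max.
  under eq_bigr do rewrite posE.
  under [X in (_ - _ * X)%E]eq_bigr do rewrite negE.
  rewrite !sumEFin -!EFinM -EFinB /= -mulrBr -sumrB; congr (_ * _).
  apply: eq_bigr => j _; case: (leP (f _) 0) => ?; case: (leP (- f _) 0) => ?; lra.
- exact: measurable_funeneg.
- exact: measurable_funepos.
Qed.

(** * Deviation of the spectral statistic from a constant and from its mean *)

Section deviation.
Context {d : measure_display} {T : measurableType d} {R : realType}.
Context (P : probability T R).

Lemma mean_le_integrable (h : T -> R) U :
  mean_le P h U -> P.-integrable setT (EFin \o h).
Proof.
move=> [mh h0 hU]; apply/integrableP; split; first exact/measurable_EFinP.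
apply: le_lt_trans (ltry U); apply: le_trans _ hU.
rewrite le_eqVlt; apply/orP; left; apply/eqP; apply: eq_integral => w _ /=.
by rewrite ger0_norm.
Qed.

(** The mean lies within E|Y - c| <= U of any centre [c], so recentring at the mean at most doubles
    the bound. *)
Lemma mean_deviation (Y S : T -> R) (c U : R) :
  measurable_fun setT Y -> mean_le P S U -> (forall w, `|Y w - c| <= S w) ->
  mean_le P (fun w => `|Y w - fine 'E_P[Y]|) (2 * U).
Proof.
move=> mY SU YS.
have [_ S0 _] := SU.
have mYc : measurable_fun setT (fun w => Y w - c) by exact: measurable_funB.
have mN : measurable_fun setT (fun w => `|Y w - c|).
  exact: (measurableT_comp (@normr_measurable R setT)).
have NU : mean_le P (fun w => `|Y w - c|) U by apply: mean_le_dominated SU.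
have intYc : P.-integrable setT (EFin \o (fun w => Y w - c)).
  apply: le_integrable (mean_le_integrable NU) => //.
    exact/measurable_EFinP.
  by move=> w _ /=; rewrite lee_fin normr_id.
have U0 : 0 <= U.
  have [_ _] := SU; rewrite -lee_fin; apply: le_trans.
  by apply: integral_ge0 => w _; rewrite lee_fin.
have intc : P.-integrable setT (EFin \o cst c).
  exact: finite_measure_integrable_cst.
have EY : fine 'E_P[Y] = c + \int[P]_w (Y w - c).
  rewrite unlock.
  have -> : (fun w => (Y w)%:E) = EFin \o (fun w => cst c w + (Y w - c)).
    by apply/funext => w /=; rewrite addrC subrK.
  have := RintegralD measurableT intc intYc; rewrite /Rintegral => -> /=.
  rewrite integral_cst // [X in (_ * X)%E](_ : _ = 1%E) ?mule1 //.
  exact: probability_setT.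
have dE : `|fine 'E_P[Y] - c| <= U.
  rewrite EY addrC addKr; apply: (le_trans (le_normr_Rintegral _ intYc)) => //.
  have [_ _ hU] := NU; rewrite -lee_fin /Rintegral fineK //.
  by apply: integrable_fin_num => //; exact: mean_le_integrable NU.
have mD : measurable_fun setT (fun w => `|Y w - fine 'E_P[Y]|).
  by apply: (measurableT_comp (@normr_measurable R setT)); exact: measurable_funB.
rewrite mulr2n mulrDl !mul1r.
apply: (mean_le_dominated mD _ _ (mean_leD SU (mean_le_cst P U0))) => // w.
rewrite (_ : Y w - _ = (Y w - c) - (fine 'E_P[Y] - c)); last ring.
by rewrite (le_trans (ler_normB _ _)) // lerD.
Qed.

End deviation.

Section truncated_approximation.
Context {d : measure_display} {T : measurableType d} {R : realType}.
Context (P : probability T R) (n : nat) (X : 'I_n -> 'I_n -> {RV P >-> R}).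
Context (Pi : {set {set 'I_n * 'I_n}}).

(** The terms of the bound are, in order: the exchange of [f] for [q]; the first-order effect of
    rounding, split by Young's inequality with parameter [s], together with the second-order one;
    and the fluctuation of the rounded sum, split with parameter [t]. Entries of squared size at
    most L^2 / n make the powers of n cancel in the block variance. *)
Lemma truncated_approximation (f q : R -> R) (C M D e K1 L e1 s t r : R) :
  (forall w, (random_mx X w)^T = random_mx X w) ->
  finset.partition Pi (upper_triangle n) ->
  independent_family P Pi (fun B => block_vector X B) ->
  (forall B, B \in Pi -> #|B|%:R <= D) -> 0 <= D ->
  0 <= e -> (forall x, `|f x - q x| <= e * (1 + x ^+ 2)) ->
  quad_taylor q C M -> (0 < n)%N -> 0 <= L -> 0 < s -> 0 < t -> 0 < r ->
  (forall i j, mean_le P (fun w => n%:R * X i j w ^+ 2) K1) ->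
  (forall i j, mean_le P (fun w => if L ^+ 2 <= n%:R * X i j w ^+ 2
                                   then n%:R * X i j w ^+ 2 else 0) e1) ->
  exists c S, mean_le P S
    (e * (1 + K1) + s * M ^+ 2 / 2 + ((2 * s)^-1 + C) * (r ^+ 2 + e1) + t +
     (4 * D * L ^+ 2 * M ^+ 2 + 4 * C ^+ 2 * D * L ^+ 4) / (n%:R ^+ 2 * t)) /\
    forall w, `|n%:R^-1 * eigensum f (random_mx X w) - c| <= S w.
Proof.
move=> Xsym part indep cardB D0 e0 fq qt n0 L0 s0 t0 r0 XK1 Xe1.
have [C0 M0] := quad_taylor_ge0 qt.
have N0 : 0 < n%:R :> R by rewrite ltr0n.
pose v : R := Num.sqrt n%:R.
have v0 : 0 < v by rewrite sqrtr_gt0.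
have vv : v ^+ 2 = n%:R by rewrite sqr_sqrtr // ltW.
have [m [idx [val [midx valL val_near val_far]]]] :=
  rounding (divr_ge0 L0 (ltW v0)) (divr_gt0 r0 v0).
have val2 i : val i ^+ 2 <= L ^+ 2 / n%:R.
  rewrite -vv -expr_div_n -real_normK ?num_real // lerXn2r ?nnegrE //.
  by rewrite divr_ge0 // ltW.
have [c0 c0P] := block_rounding_variance Xsym part indep midx cardB D0 qt val2.
set Z := (fun w => \matrix_(i, j) val (idx (X i j w))) in c0P.
have Xs w i j : X j i w = X i j w.
  by have /matrixP/(_ i j) := Xsym w; rewrite !mxE.
have Zsym w : (Z w)^T = Z w by apply/matrixP => i j; rewrite !mxE Xs.
pose A w := random_mx X w.
have nn : #|{: 'I_n * 'I_n}|%:R = n%:R ^+ 2 :> R.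
  by rewrite card_prod card_ord natrM expr2.
have hA : mean_le P (fun w => n%:R^-1 * entry_dot (A w) (A w)) K1.
  have -> : (fun w => n%:R^-1 * entry_dot (A w) (A w)) = (fun w => n%:R^-1 *
      \sum_(p : 'I_n * 'I_n) n%:R^-1 * (n%:R * X p.1 p.2 w ^+ 2)).
    apply/funext => w; congr (_ * _); apply: eq_bigr => p _.
    by rewrite mulKf ?gt_eqF // !mxE expr2.
  have Ni : 0 <= n%:R^-1 :> R by rewrite invr_ge0.
  apply: mean_le_bound (mean_leZ Ni (mean_le_sum
    (fun p => mean_leZ Ni (XK1 p.1 p.2)))) _.
  by rewrite nn le_eqVlt; apply/orP; left; apply/eqP; field; rewrite gt_eqF.
have hD : mean_le P (fun w => n%:R^-1 * entry_dot (Z w - A w) (Z w - A w))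
    (r ^+ 2 + e1).
  have Ni : 0 <= n%:R^-1 :> R by rewrite invr_ge0.
  have entry p : mean_le P (fun w => (val (idx (X p.1 p.2 w)) - X p.1 p.2 w) ^+ 2)
      (r ^+ 2 / n%:R + n%:R^-1 * e1).
    have r2 : 0 <= r ^+ 2 / n%:R by rewrite divr_ge0 ?sqr_ge0.
    apply: (mean_le_dominated _ _ _
      (mean_leD (mean_le_cst P r2) (mean_leZ Ni (Xe1 p.1 p.2)))).
    - apply: measurable_funX; apply: measurable_funB => //.
      apply: (measurable_finite_comp (z := idx \o X p.1 p.2) _ val) => u.
      rewrite comp_preimage -[X in measurable X]setTI.
      exact: (measurable_funPT (X p.1 p.2)).
    - by move=> w; exact: sqr_ge0.
    - move=> w; set x := X p.1 p.2 w.
      (* Small entries err by the mesh r / sqrt n. Large ones are rounded to 0, so their error is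
         the entry itself, which the tail bound [e1] controls. *)
      have [xL|xL] := leP `|x| (L / v).
        apply: (@le_trans _ _ (r ^+ 2 / n%:R)).
          rewrite -vv -expr_div_n -real_normK ?num_real // lerXn2r ?nnegrE //.
            by rewrite divr_ge0 // ltW.
          exact: val_near.
        rewrite lerDl mulr_ge0 //; case: ifP => // _.
        by rewrite mulr_ge0 ?sqr_ge0.
      rewrite val_far // sub0r sqrrN ifT; last first.
        rewrite -vv -exprMn -[(v * x) ^+ 2]real_normK ?num_real //.
        rewrite lerXn2r ?nnegrE //.
        by rewrite normrM (gtr0_norm v0) mulrC -ler_pdivrMr // ltW.
      by rewrite mulKf ?gt_eqF // lerDr.
  have -> : (fun w => n%:R^-1 * entry_dot (Z w - A w) (Z w - A w)) =
    (fun w => n%:R^-1 *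
      \sum_(p : 'I_n * 'I_n) (val (idx (X p.1 p.2 w)) - X p.1 p.2 w) ^+ 2).
    apply/funext => w; congr (_ * _); apply: eq_bigr => p _.
    by rewrite !mxE expr2.
  apply: mean_le_bound (mean_leZ Ni (mean_le_sum entry)) _.
  by rewrite nn le_eqVlt; apply/orP; left; apply/eqP; field; rewrite gt_eqF.
have nt0 : 0 < n%:R ^+ 2 * t by rewrite mulr_gt0 ?exprn_gt0.
pose S w := e * (1 + n%:R^-1 * entry_dot (A w) (A w)) + s * M ^+ 2 / 2 +
  ((2 * s)^-1 + C) * (n%:R^-1 * entry_dot (Z w - A w) (Z w - A w)) + t +
  (n%:R ^+ 2 * t)^-1 * (eigensum q (Z w) - c0) ^+ 2.
exists (n%:R^-1 * c0), S; split.
  have s2 : 0 <= (2 * s)^-1 + C by rewrite addr_ge0 // invr_ge0 mulr_ge0 // ltW.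
  have M2 : 0 <= s * M ^+ 2 / 2 by rewrite divr_ge0 // mulr_ge0 ?sqr_ge0 // ltW.
  have nti : 0 <= (n%:R ^+ 2 * t)^-1 by rewrite invr_ge0 ltW.
  apply: mean_le_bound (mean_leD (mean_leD (mean_leD (mean_leD
    (mean_leZ e0 (mean_leD (mean_le_cst P ler01) hA)) (mean_le_cst P M2))
    (mean_leZ s2 hD)) (mean_le_cst P (ltW t0))) (mean_leZ nti c0P)) _.
  by rewrite le_eqVlt; apply/orP; left; apply/eqP; field; rewrite !gt_eqF.
move=> w; rewrite /S.
have h1 := eigensum_dist fq (Xsym w).
have [G [GM GT]] := eigensum_taylor qt (Xsym w).
have h2 := GT _ (Zsym w).
rewrite -/(A w) in h1 h2 *.
set u := entry_dot (A w) (A w) in h1 *.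
set y := entry_dot (Z w - A w) _ in h2 *.
(* Young's inequality entry by entry: the mass of [G] is only O(n), so it gets the small weight [s],
   while the large weight 1/(2 s) falls on the small rounding error. *)
have h3 : `|entry_dot G (Z w - A w)| <= s * (n%:R * M ^+ 2) / 2 + (2 * s)^-1 * y.
  apply: (@le_trans _ _ (s / 2 * entry_dot G G + (2 * s)^-1 * y)).
    rewrite /y /entry_dot !mulr_sumr -big_split.
    apply: (le_trans (ler_norm_sum _ _ _)); apply: ler_sum => p _ /=.
    move: (G _ _) ((Z w - A w) _ _) => a b.
    have E (z : R) : z ^+ 2 = 1 -> s / 2 * (a * a) + (2 * s)^-1 * (b * b) - z * (a * b) =
        (2 * s)^-1 * (s * a - z * b) ^+ 2.
      move=> z2; transitivity (s / 2 * (a * a) +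
          (2 * s)^-1 * (z ^+ 2 * (b * b)) - z * (a * b)); first by rewrite z2 mul1r.
      by field; rewrite gt_eqF.
    have pos z : 0 <= (2 * s)^-1 * (s * a - z * b) ^+ 2.
      by rewrite mulr_ge0 ?sqr_ge0 // invr_ge0 mulr_ge0 // ltW.
    have := pos 1; have := pos (-1).
    rewrite -!E ?sqrrN ?expr1n // => ? ?; rewrite ler_norml; apply/andP; split; lra.
  rewrite lerD2r [s * _ / 2]mulrAC ler_wpM2l //; first by rewrite divr_ge0 // ltW.
(* This pointwise inequality leads from the second moment to the first. *)
have h4 (x : R) : `|x| <= n%:R * t + (n%:R * t)^-1 * x ^+ 2.
  have nt : 0 < n%:R * t by rewrite mulr_gt0.
  have E : n%:R * t + (n%:R * t)^-1 * x ^+ 2 - `|x| =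
      (n%:R * t)^-1 * ((n%:R * t - `|x| / 2) ^+ 2 + 3 / 4 * `|x| ^+ 2).
    rewrite -[x ^+ 2]real_normK ?num_real //; field.
    by rewrite !gt_eqF.
  rewrite -subr_ge0 E; apply: mulr_ge0; first by rewrite invr_ge0 ltW.
  by have := sqr_ge0 (n%:R * t - `|x| / 2); have := sqr_ge0 `|x|; lra.
have h5 := h4 (eigensum q (Z w) - c0).
have key : `|eigensum f (A w) - c0| <= e * (n%:R + u) +
    s * (n%:R * M ^+ 2) / 2 + ((2 * s)^-1 + C) * y + n%:R * t +
    (n%:R * t)^-1 * (eigensum q (Z w) - c0) ^+ 2.
  move: h1 h2 h3 h5; rewrite mulrDl.
  move: (eigensum f _) (eigensum q _) (eigensum q _) (entry_dot _ _) => a b b' g.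
  rewrite !ler_norml => /andP[? ?] /andP[? ?] /andP[? ?] /andP[? ?].
  by apply/andP; split; lra.
have Ni : 0 <= n%:R^-1 :> R by rewrite invr_ge0.
have := ler_wpM2l Ni key.
rewrite -[X in X * `|_|](ger0_norm Ni) -normrM mulrBr => /le_trans; apply.
by rewrite le_eqVlt; apply/orP; left; apply/eqP; field; rewrite !gt_eqF.
Qed.

End truncated_approximation.

(** * Tails, limits and the choice of parameters *)

Lemma mean_le_tail (d : measure_display) (T : measurableType d) (R : realType)
    (P : probability T R) (h : T -> R) (K L e : R) :
  measurable_fun setT h -> (forall w, 0 <= h w) -> K <= L ->
  (\int[P]_(w in [set w | (K <= `|h w|)%R]) `|h w|%:E <= e%:E)%E ->
  mean_le P (fun w => if L <= h w then h w else 0) e.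
Proof.
move=> mh h0 KL hK.
have mtail a : measurable_fun setT (fun w => if a <= h w then h w else 0).
  apply: measurable_fun_ifT => //.
  by apply: measurable_fun_ler.
have tailK : mean_le P (fun w => if K <= h w then h w else 0) e.
  split=> // [w|]; first by case: ifP.
  apply: le_trans _ hK; rewrite [leRHS]integral_mkcond.
  rewrite le_eqVlt; apply/orP; left; apply/eqP; apply: eq_integral => w _.
  rewrite /patch; case: ifP => Kh.
    by rewrite ifT ?ger0_norm // inE /= ger0_norm.
  by rewrite ifF //; apply/negP; rewrite inE /= ger0_norm // Kh.
apply: mean_le_dominated tailK => // w; first by case: ifP.
case: ifP => [Lh|_]; first by rewrite (le_trans KL).
by case: ifP.
Qed.

Lemma cvg_to0_le (R : realType) (u : nat -> \bar R) :
  (forall n, 0 <= u n)%E ->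
  (forall e : R, 0 < e -> \forall n \near \oo, (u n <= e%:E)%E) ->
  u n @[n --> \oo] --> 0%E.
Proof.
move=> u0 ue; apply/fine_cvgP; split.
  near=> n; rewrite ge0_fin_numE //.
  apply: (@le_lt_trans _ _ 1%:E); last exact: ltry.
  by near: n; exact: ue.
apply/cvgrPdist_le => e e0; near=> n.
rewrite sub0r normrN ger0_norm ?fine_ge0 //=.
have une : (u n <= e%:E)%E by near: n; exact: ue.
by rewrite -lee_fin fineK // ge0_fin_numE // (le_lt_trans une) ?ltry.
Unshelve. all: by end_near. Qed.

(** Taking 1 as the little-o constant, it follows from ln n <= n - 1. *)
Lemma littleo_ln_le_natr (R : realType) (d : nat -> R) :
  (d : nat -> R^o) =o_\oo (fun n : nat => ln n%:R : R^o) ->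
  \forall n \near \oo, d n <= n%:R.
Proof.
move=> /eqoP/(_ 1 ltr01) dln; near=> n.
have n0 : (0 < n)%N by near: n; exact: nbhs_infty_gt.
have n1 : 1 <= n%:R :> R by rewrite ler1n.
have h : `|d n| <= 1 * `|ln n%:R : R| by near: n; exact: dln.
rewrite mul1r (ger0_norm (ln_ge0 n1)) in h.
apply: (le_trans (ler_norm _)); apply: (le_trans h).
have := @le_ln1Dx R (n%:R - 1); rewrite [1 + _]addrC subrK => lnn.
by apply: le_trans (lnn _) _; lra.
Unshelve. all: by end_near. Qed.

Theorem theorem1p1 (R : realType)
  (disp : nat -> measure_display)
  (T : forall N : nat, measurableType (disp N))
  (P : forall N : nat, probability (T N) R)
  (X : forall N : nat, 'I_N -> 'I_N -> {RV (P N) >-> R})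
  (Xsym : forall (N : nat) (w : T N),
    (random_mx (X N) w)^T = random_mx (X N) w)
  (Xui : uniformly_integrable
    (fun k : {N : nat & ('I_N * 'I_N)%type} => P (tag k))
    (fun k w => (tag k)%:R * X (tag k) (tagged k).1 (tagged k).2 w ^+ 2))
  (Pi : forall N : nat, {set {set 'I_N * 'I_N}})
  (d : nat -> R)
  (Pi_partition : forall N : nat,
    finset.partition (Pi N) (upper_triangle N))
  (d_littleo : (d : nat -> R^o) =o_\oo (fun N : nat => ln N%:R : R^o))
  (Pi_card : forall (N : nat) (B : {set 'I_N * 'I_N}),
    B \in Pi N -> #|B|%:R <= d N)
  (Pi_independent : forall N : nat,
    independent_family (P N) (Pi N) (fun B => block_vector (X N) B)) :
  forall f : R -> R, continuous f -> bounded_fun f ->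
    let Y (N : nat) (w : T N) := (\int[esd (random_mx (X N) w)]_x f x)%R in
    cvg_in_probability P (fun N w => Y N w - fine ('E_(P N)[Y N])) 0.
Proof.
move=> f cf bf Y.
have [F fF] : exists F, forall x, `|f x| <= F.
  have [F [_ hF]] := bf; exists (F + 1) => x.
  by apply: (hF (F + 1)); rewrite ?ltrDl.
have YE N w : Y N w = N%:R^-1 * eigensum f (random_mx (X N) w).
  by rewrite /Y Rintegral_esd //; exact: continuous_measurable_fun.
have mY N : measurable_fun setT (Y N).
  rewrite (_ : Y N = fun w => N%:R^-1 * eigensum f (random_mx (X N) w)).
    apply: measurable_funM => //; exact: measurable_eigensum fF.
  by apply/funext => w; exact: YE.
have X2ge0 N i j w : 0 <= N%:R * X N i j w ^+ 2 by rewrite mulr_ge0 ?sqr_ge0.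
have mX2 N i j : measurable_fun setT (fun w => N%:R * X N i j w ^+ 2).
  by apply: measurable_funM => //; exact: measurable_funX.
have tail e : 0 < e -> exists2 L, 0 <= L & forall N i j, mean_le (P N)
    (fun w => if L ^+ 2 <= N%:R * X N i j w ^+ 2
              then N%:R * X N i j w ^+ 2 else 0) e.
  (* The square root of |K| makes L^2 = |K| a threshold above [K], whatever its sign. *)
  move=> /Xui[K hK]; exists (Num.sqrt `|K|) => // N i j.
  apply: (mean_le_tail (K := K)) => //; first by rewrite sqr_sqrtr // ler_norm.
  exact: (hK (existT _ N (i, j))).
have [K1 XK1] : exists K1, forall N i j,
    mean_le (P N) (fun w => N%:R * X N i j w ^+ 2) K1.
  have [L L0 hL] := tail 1 ltr01; exists (L ^+ 2 + 1) => N i j.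
  apply: (mean_le_dominated _ _ _
    (mean_leD (mean_le_cst (P N) (sqr_ge0 L)) (hL N i j))) => // w.
  case: ifPn => [_|]; first by rewrite lerDr sqr_ge0.
  by rewrite -ltNge addr0 => /ltW.
have K10 : 0 <= `|K1| by [].
move=> a a0; apply: cvg_to0_le => [N|e e0]; first exact: measure_ge0.
(* Five error terms of at most [H], doubled by recentring at the mean and divided by [a] in Markov's
   inequality, give 10 H / a = e. *)
pose H := e * a / 10.
have H0 : 0 < H by rewrite /H !mulr_gt0.
pose e' := H / (1 + `|K1|).
have e'0 : 0 < e' by rewrite divr_gt0 //; lra.
have [q [C [M [qt fq]]]] := quad_approximation cf fF e'0.
have [C0 M0] := quad_taylor_ge0 qt.
pose s := 2 * H / (M ^+ 2 + 1).
have M21 : 0 < M ^+ 2 + 1 by have := sqr_ge0 M; lra.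
have s0 : 0 < s by rewrite divr_gt0 // mulr_gt0.
pose B := (2 * s)^-1 + C.
have B0 : 0 < B by rewrite ltr_pwDl // invr_gt0 mulr_gt0.
(* The rounding term is B (r^2 + e1) <= 2 B e1 = H, since [r] is at most both 1 and [e1]. *)
pose e1 := H / (2 * B).
have e10 : 0 < e1 by rewrite divr_gt0 // mulr_gt0.
pose r := Num.min 1 e1.
have r0 : 0 < r by rewrite lt_min ltr01 e10.
(* [L] depends on [e1], hence on the constants of [q]; uniform integrability makes it independent of
   N, and it is fixed before N is sent to infinity. *)
have [L L0 XL] := tail e1 e10.
pose E := 4 * L ^+ 2 * M ^+ 2 + 4 * C ^+ 2 * L ^+ 4.
have E0 : 0 <= E.
  by rewrite addr_ge0 // ?mulr_ge0 ?sqr_ge0 // exprn_ge0.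
near=> N.
have N0 : (0 < N)%N by near: N; exact: nbhs_infty_gt.
have N0' : 0 < N%:R :> R by rewrite ltr0n.
have dN : d N <= N%:R by near: N; exact: littleo_ln_le_natr.
(* With block size at most N and t = H, the fluctuation term is N E / (N^2 H) = E / (N H), at most
   [H] for these N. *)
have NE : E / (H * H) <= N%:R by near: N; exact: nbhs_infty_ger.
have cardB (A : {set 'I_N * 'I_N}) : A \in Pi N -> #|A|%:R <= N%:R :> R.
  by move=> /Pi_card /le_trans; apply.
have [c [S [SU YS]]] := truncated_approximation (@Xsym N) (Pi_partition N)
  (Pi_independent N) cardB (ler0n _ _) (ltW e'0) fq qt N0 L0 s0 H0 r0
  (XK1 N) (XL N).
have YS' w : `|Y N w - c| <= S w by rewrite YE.
have dev := mean_deviation (mY N) SU YS'.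
rewrite (_ : mkset _ = [set w | a < `|Y N w - fine 'E_(P N)[Y N]|]); last first.
  by apply/seteqP; split=> w /=; rewrite subr0.
apply: le_trans (mean_le_markov a0 dev) _.
rewrite lee_fin ler_pdivrMr //.
have -> : e * a = 2 * (H + H + H + H + H) by rewrite /H; field.
rewrite ler_pM2l //; apply: lerD; first (apply: lerD => //; apply: lerD; first apply: lerD).
- rewrite /e' mulrAC ler_pdivrMr; last lra.
  by rewrite ler_pM2l //; have := ler_norm K1; lra.
- rewrite /s ler_pdivrMr // mulrAC ler_pdivrMr //.
  have := sqr_ge0 M; nra.
- rewrite -/B.
  have r1 : r ^+ 2 <= e1.
    have r_le1 : r <= 1 by rewrite ge_min lexx.
    have r_le : r <= e1 by rewrite ge_min lexx orbT.
    by rewrite expr2; nra.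
  have e1E : B * (2 * e1) = H by rewrite /e1; field; rewrite gt_eqF.
  rewrite -e1E ler_pM2l //; lra.
rewrite ler_pdivrMr ?mulr_gt0 ?exprn_gt0 //.
move: NE; rewrite ler_pdivrMr ?mulr_gt0 // => NE.
have -> : 4 * N%:R * L ^+ 2 * M ^+ 2 + 4 * C ^+ 2 * N%:R * L ^+ 4 = N%:R * E.
  by rewrite /E; ring.
have -> : H * (N%:R ^+ 2 * H) = N%:R * (N%:R * (H * H)) by ring.
by rewrite ler_pM2l.
Unshelve. all: by end_near. Qed.
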